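(* Let $(\Omega,\mathcal F,\mathbb P)$ be a non-atomic probability space, let $\Sigma$ be the collection of all sub-$\sigma$-algebras of $\mathcal F$, and let $\{\mathcal E_{\mathcal G}\}_{\mathcal G\in\Sigma}$ be a family of maps $\mathcal E_{\mathcal G}:L^\infty(\Omega,\mathcal F,\mathbb P)\to L^\infty(\Omega,\mathcal G,\mathbb P)$. Then the following are equivalent: (a) $\{\mathcal E_{\mathcal G}\}_{\mathcal G\in\Sigma}$ is a time consistent family of conditional nonlinear expectations and $\mathcal E_0$ is strictly monotone on dichotomic random variables and pointwise continuous (both notions as defined in the context); (b) there exists a function $\mathbb u:\Omega\times\mathbb R\to\mathbb R$ which is $\mathcal F$-regular and such that $\mathbb u(\cdot,x)$ is $\mathbb P$-integrable for every $x\in\mathbb R$, and for every $\mathcal G\in\Sigma$ there is a $\mathcal G$-regular function $\mathbb u_{\mathcal G}$ such that, for every $x\in\mathbb R$, $\mathbb u_{\mathcal G}(\cdot,x)$ is $\mathbb P$-integrable and is a version of $\mathbb E_{\mathbb P}[\mathbb u(\cdot,x)\mid\mathcal G]$, and such that for every $X\in L^\infty(\Omega,\mathcal F,\mathbb P)$ $$\mathcal E_{\mathcal G}(X)=\mathbb u_{\mathcal G}^{-1}\big(\mathbb E_{\mathbb P}[\mathbb u(X)\mid \mathcal G]\big).$$ Here $\mathbb u_{\mathcal G}^{-1}(\mathbb E_{\mathbb P}[\mathbb u(X)\mid\mathcal G])$ denotes the $\mathbb P$-equivalence class of $\omega\mapsto\Phi_{\mathcal G}(\omega,h(\omega))$,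 where $f$ is any representative of $X$, $h$ is a version of $\mathbb E_{\mathbb P}[\mathbb u(\cdot,f(\cdot))\mid\mathcal G]$ with $h(\omega)\in\{\mathbb u_{\mathcal G}(\omega,y):y\in\mathbb R\}$ for every $\omega$ (such a version exists, and the resulting class does not depend on the choices), and $\Phi_{\mathcal G}(\omega,x):=\inf\{y\in\mathbb R:\mathbb u_{\mathcal G}(\omega,y)>x\}$.
   Context: $L^\infty(\Omega,\mathcal G,\mathbb P)$ is the space of $\mathbb P$-a.s. equivalence classes of bounded $\mathcal G$-measurable real random variables. $\mathcal E_0$ denotes $\mathcal E_{\mathcal G}$ for the trivial $\sigma$-algebra $\mathcal G=\{\varnothing,\Omega\}$ (so $\mathcal E_0$ is real-valued). A map $\mathcal E_{\mathcal G}$ is a conditional nonlinear expectation if $\mathcal E_{\mathcal G}(X1_A)=\mathcal E_{\mathcal G}(X)1_A$ for all $X\in L^\infty(\Omega,\mathcal F,\mathbb P)$ and $A\in\mathcal G$. The family is time consistent if $\mathcal E_0(\mathcal E_{\mathcal G}(X))=\mathcal E_0(X)$ for all $\mathcal G\in\Sigma$ and all $X$. $\mathcal E_0$ is strictly monotone on dichotomic random variables if for all $x<y$ in $\mathbb R$, $Z\in L^\infty(\Omega,\mathcal F,\mathbb P)$ and $A\in\mathcal F$ with $\mathbb P(A)>0$: $\mathcal E_0(x1_A+Z1_{A^c})<\mathcal E_0(y1_A+Z1_{A^c})$. $\mathcal E_0$ is pointwise continuous if $\mathcal E_0(X_n)\to\mathcal E_0(X)$ for every uniformly bounded sequence $X_n$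 converging $\mathbb P$-a.s. to $X$. For a sub-$\sigma$-algebra $\mathcal G\subseteq\mathcal F$, a function $\varphi:\Omega\times\mathbb R\to\mathbb R$ is $\mathcal G$-regular if $\varphi(\omega,\cdot)$ is continuous and strictly increasing on $\mathbb R$ for every $\omega$, $\varphi(\omega,0)=0$ for every $\omega$, and $\varphi$ is $\mathcal G\otimes\mathcal B_{\mathbb R}$-measurable. *)

(* Defs.v *)
From HB Require Import structures.
From mathcomp Require Import all_boot all_order all_algebra.
From mathcomp Require Import all_classical all_reals all_analysis.
Set Implicit Arguments. Unset Strict Implicit. Unset Printing Implicit Defensive.
Import Order.TTheory GRing.Theory Num.Theory.
Import numFieldNormedType.Exports.
Local Open Scope classical_set_scope.
Local Open Scope ring_scope.

Section defs.
Context {d : measure_display} {T : measurableType d} {R : realType}.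

Definition Fsig : set (set T) := @measurable d T.

Definition trivsig : set (set T) := [set set0; setT].

Definition sub_sigma (G : set (set T)) : Prop :=
  sigma_algebra setT G /\ G `<=` Fsig.

Definition G_meas (G : set (set T)) (f : T -> R) : Prop :=
  forall B : set R, measurable B -> G (f @^-1` B).

Definition Linf_rep (G : set (set T)) (f : T -> R) : Prop :=
  G_meas G f /\ exists M : R, forall w, `|f w| <= M.

Definition aeeq (P : probability T R) (f g : T -> R) : Prop :=
  {ae P, forall w, f w = g w}.

Definition nonatomic (P : probability T R) : Prop :=
  forall A, measurable A -> (0 < P A)%E ->
    exists B, [/\ measurable B, B `<=` A, (0 < P B)%E & (P B < P A)%E].

Definition prod_sigma (G : set (set T)) : set (set (T * R)) :=
  smallest (sigma_algebra setT)
    [set S | exists A B, [/\ G A, measurable B & S = A `*` B]].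

Definition regular (G : set (set T)) (phi : T -> R -> R) : Prop :=
  [/\ forall w, continuous (phi w),
      forall w x y, x < y -> phi w x < phi w y,
      forall w, phi w 0 = 0 &
      forall B : set R, measurable B ->
        prod_sigma G ((fun p : T * R => phi p.1 p.2) @^-1` B)].

Definition condexp_version (P : probability T R) (G : set (set T))
    (g h : T -> R) : Prop :=
  [/\ G_meas G h, P.-integrable setT (EFin \o h) &
      forall A, G A ->
        (\int[P]_(w in A) (h w)%:E = \int[P]_(w in A) (g w)%:E)%E].

Definition Phi (phi : T -> R -> R) (w : T) (x : R) : R :=
  inf [set y | x < phi w y].

(* A family of maps E_G : L^oo(F) -> L^oo(G), presented on representatives:
   sends bounded F-measurable functions to bounded G-measurable ones, and
   respects P-a.s. equality. *)
Definition Linf_family (P : probability T R)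
    (E : set (set T) -> (T -> R) -> (T -> R)) : Prop :=
  forall G, sub_sigma G ->
    (forall f, Linf_rep Fsig f -> Linf_rep G (E G f)) /\
    (forall f g, Linf_rep Fsig f -> Linf_rep Fsig g -> aeeq P f g ->
       aeeq P (E G f) (E G g)).

Definition cond_nonlin_exp (P : probability T R)
    (E : set (set T) -> (T -> R) -> (T -> R)) : Prop :=
  forall G, sub_sigma G ->
    forall f, Linf_rep Fsig f -> forall A, G A ->
      aeeq P (E G (fun w => f w * \1_A w)) (fun w => E G f w * \1_A w).

(* Time consistency: E_0(E_G(X)) = E_0(X); E_0 is real valued (constant
   functions), so we compare the values at every point. *)
Definition time_consistent (E : set (set T) -> (T -> R) -> (T -> R)) : Prop :=
  forall G, sub_sigma G -> forall f, Linf_rep Fsig f ->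
    forall w, E trivsig (E G f) w = E trivsig f w.

Definition strict_mono_dichotomic (P : probability T R)
    (E : set (set T) -> (T -> R) -> (T -> R)) : Prop :=
  forall (x y : R) (Z : T -> R) (A : set T),
    x < y -> Linf_rep Fsig Z -> measurable A -> (0 < P A)%E ->
    forall w,
      E trivsig (fun v => x * \1_A v + Z v * \1_(~` A) v) w <
      E trivsig (fun v => y * \1_A v + Z v * \1_(~` A) v) w.

Definition pointwise_continuous (P : probability T R)
    (E : set (set T) -> (T -> R) -> (T -> R)) : Prop :=
  forall (X : nat -> T -> R) (f : T -> R),
    (forall n, Linf_rep Fsig (X n)) -> Linf_rep Fsig f ->
    (exists M : R, forall n w, `|X n w| <= M) ->
    {ae P, forall w, (fun n => X n w) @ \oo --> f w} ->
    forall w, (fun n => E trivsig (X n) w) @ \oo --> E trivsig f w.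

End defs.

(* Main.v *)
(** Necessity of the representation.  Conditioning on a sigma-algebra with atom [A]
    shows that [I := E_0] satisfies Savage's sure-thing principle: the ranking of two
    functions that agree off [A] does not depend on their common part.  For constants
    [a < b] the events are then ordered by [S |-> I (b 1_S + a 1_S^c)] as by a
    qualitative probability.  Non-atomicity and continuity allow every event to be
    halved repeatedly, and counting the dyadic cells below a value of [I] gives a scale
    [phi] such that [phi o I] is additive over disjoint events, on functions
    with values in [a, b]; such a scale is unique up to affine maps, so the normalised
    scales of growing intervals fit together into an additive continuous functional
    [V = phi o I] on all bounded functions.  On every sub-sigma-algebra [G] the set
    functions [A |-> V (x 1_A)] have densities; continuity of [V] along random grid points
    forbids jumps in [x], which yields a [G]-regular [u_G] with [V f = E (u_G (f))]
    for [G]-measurable [f].  Since [V (E_G (f) 1_A) = V (f 1_A)] for [A] in [G],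
    [u_G (E_G f)] is a version of [E (u (f) | G)].

    Sufficiency.  With [J f := E (u (f))] one has [J (E_G f) = J f], so that [E_0 f]
    is the certainty equivalent of [f] under [J], and the properties of [E] follow from
    those of the integral. *)
Require Import Defs.
From HB Require Import structures.
From mathcomp Require Import all_boot all_order all_algebra.
From mathcomp Require Import all_classical all_reals all_analysis.
From mathcomp Require Import lra ring measurable_realfun.
Set Implicit Arguments.
Unset Strict Implicit.
Import Order.TTheory GRing.Theory Num.Theory.
Import numFieldNormedType.Exports.
Local Open Scope classical_set_scope.
Local Open Scope ring_scope.

(** * Gluing functions and sub-sigma-algebras *)

Section sigma.
Context {d : measure_display} {T : measurableType d} {R : realType}.
Implicit Types (G : set (set T)) (f g : T -> R) (A B : set T).

(** For each [x] the density of [A |-> V (x 1_A)] is fixed only up to a null set depending on [x],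
    whereas a regular integrand has to be continuous and increasing in [x] at every point of [T].
    This is why only rational [x] are used: monotonicity and small oscillation then amount to
    countably many conditions, they hold on a set of full measure that lies in [G], and off this set
    the identity replaces the densities.

    The same functional [V] serves every [G]: [u] and [u_G] come from one construction, applied to
    [Fsig] and to [G]. So [u_G (x)] is a version of [E (u (x) | G)] simply because both integrate
    over [A] in [G] to [V (x 1_A)].

    Additivity for functions is reduced to events. On [A], a function with values in [[a, b]] is
    exchanged for a bet on an event inside [A] of equal rank, and the sure-thing principle allows
    the exchange whatever happens off [A]. Events of prescribed rank come from an intermediate value
    theorem for set functions, proved by exhaustion. *)

Definition glue A f g : T -> R := fun w => if w \in A then f w else g w.

Lemma glueT A f g w : A w -> glue A f g w = f w.
Proof. by move=> Aw; rewrite /glue mem_set. Qed.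

Lemma glueF A f g w : ~ A w -> glue A f g w = g w.
Proof. by move=> Aw; rewrite /glue memNset. Qed.

Lemma glue_indic A f g :
  (fun w => f w * \1_A w + g w * \1_(~` A) w) = glue A f g.
Proof.
apply/funext => w; rewrite !indicE; have [Aw|nAw] := pselect (A w).
  by rewrite glueT// mem_set// memNset ?mulr1 ?mulr0 ?addr0//; apply.
by rewrite glueF// memNset// mem_set// ?mulr1 ?mulr0 ?add0r.
Qed.

Lemma mul_indic A f : (fun w => f w * \1_A w) = glue A f (cst 0).
Proof.
rewrite -glue_indic; apply/funext => w.
by rewrite /= mul0r addr0.
Qed.

Lemma glue_eq A f g f' g' : (forall w, A w -> f w = f' w) ->
  (forall w, ~ A w -> g w = g' w) -> glue A f g = glue A f' g'.
Proof.
move=> ff' gg'; apply/funext => w; have [Aw|nAw] := pselect (A w).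
  by rewrite !glueT// ff'.
by rewrite !glueF// gg'.
Qed.

Lemma glue_id A f : glue A f f = f.
Proof. by apply/funext => w; rewrite /glue; case: ifP. Qed.

Lemma glueC A f g : glue (~` A) f g = glue A g f.
Proof.
apply/funext => w; have [Aw|nAw] := pselect (A w).
  by rewrite glueF ?glueT//; apply.
by rewrite glueT ?glueF.
Qed.

Lemma sub_sigmaF : sub_sigma (@Fsig d T).
Proof. by split => //; exact: sigma_algebra_measurable. Qed.

Lemma sub_sigma_triv : sub_sigma (@trivsig d T).
Proof.
split; last by move=> A [->|->]; rewrite /Fsig; [exact: measurable0|exact: measurableT].
split; [by left| |].
- by move=> A [->|->]; rewrite ?setD0 ?setDv; [right|left].
- move=> A hA; have [[n An]|/forallNP nA] := pselect (exists n, A n = setT).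
    right; apply/seteqP; split=> // w _; exists n => //; by rewrite An.
  left; apply/seteqP; split => // w [n _].
  by have [->//|AT] := hA n; have := nA n.
Qed.

Section subs.
Variable G : set (set T).
Hypothesis sG : sub_sigma G.
Let salg : sigma_algebra setT G := sG.1.
Let TG := g_sigma_algebraType G.

Lemma sigmaE : (@measurable _ TG) = G.
Proof. exact: measurable_g_measurableTypeE. Qed.

Lemma sigma_measurable A : G A -> measurable A.
Proof. by move=> GA; exact: sG.2. Qed.

Lemma sigma0 : G set0. Proof. by case: salg. Qed.

Lemma sigmaC A : G A -> G (~` A).
Proof. by case: salg => _ h _ GA; rewrite -setTD; exact: h. Qed.

Lemma sigmaT : G setT. Proof. by rewrite -setC0; apply: sigmaC; exact: sigma0. Qed.

Lemma sigmaI A B : G A -> G B -> G (A `&` B).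
Proof. by rewrite -sigmaE => ? ?; exact: (@measurableI _ TG). Qed.

Lemma sigmaD A B : G A -> G B -> G (A `\` B).
Proof. by rewrite -sigmaE => ? ?; exact: (@measurableD _ TG). Qed.

Lemma sigma_bigcup (F : (set T)^nat) : (forall n, G (F n)) -> G (\bigcup_n F n).
Proof. by case: salg => _ _; apply. Qed.

Lemma sigma_bigcap (F : (set T)^nat) : (forall n, G (F n)) -> G (\bigcap_n F n).
Proof.
move=> GF; rewrite -[X in G X]setCK setC_bigcap; apply: sigmaC.
by apply: sigma_bigcup => n; exact: sigmaC.
Qed.

Lemma G_measE f : G_meas G f <-> measurable_fun [set: TG] (f : TG -> R).
Proof.
split=> [mf _ B mB|mf B mB].
  by rewrite setTI sigmaE; exact: mf.
by have := mf measurableT B mB; rewrite setTI sigmaE.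
Qed.

Lemma G_meas_measurable f : G_meas G f -> measurable_fun [set: T] f.
Proof. by move=> mf _ B mB; rewrite setTI; apply: sigma_measurable; exact: mf. Qed.

Lemma G_meas_cst c : G_meas G (cst c : T -> R).
Proof. by apply/G_measE; exact: measurable_cst. Qed.

Lemma G_meas_glue A f g : G A -> G_meas G f -> G_meas G g -> G_meas G (glue A f g).
Proof.
move=> GA /G_measE mf /G_measE mg; apply/G_measE.
apply: measurable_fun_ifT => //.
by apply: (measurable_fun_bool true); rewrite setTI preimage_mem_true sigmaE.
Qed.

Lemma G_meas_lt f g : G_meas G f -> G_meas G g -> G [set w | f w < g w].
Proof.
move=> /G_measE mf /G_measE mg.
have := @measurable_fun_ltr _ TG R setT f g mf mg measurableT [set true] I.
by rewrite setTI sigmaE.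
Qed.

Lemma G_meas_le f g : G_meas G f -> G_meas G g -> G [set w | f w <= g w].
Proof.
move=> mf mg; rewrite (_ : [set w | _] = ~` [set w | g w < f w]).
  by apply: sigmaC; exact: G_meas_lt.
by apply/seteqP; split=> w /=; rewrite leNgt => /negP.
Qed.

Lemma Linf_rep_cst c : Linf_rep G (cst c : T -> R).
Proof. by split; [exact: G_meas_cst|exists `|c|]. Qed.

Lemma Linf_rep_glue A f g : G A -> Linf_rep G f -> Linf_rep G g ->
  Linf_rep G (glue A f g).
Proof.
move=> GA [mf [M fM]] [mg [N gN]]; split; first exact: G_meas_glue.
exists (Num.max M N) => w; rewrite le_max /glue; case: ifP => _.
  by rewrite fM.
by rewrite gN orbT.
Qed.

Lemma Linf_repF f : Linf_rep G f -> Linf_rep Fsig f.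
Proof. by move=> [mf bf]; split => // B mB; apply: sG.2; exact: mf. Qed.

End subs.

Lemma Linf_rep_pos G f : Linf_rep G f -> exists2 M : R, 0 < M & forall w, `|f w| <= M.
Proof.
move=> [_ [M fM]]; exists (`|M| + 1) => [|w]; first by rewrite ltr_wpDl.
by rewrite (le_trans (fM w))// (le_trans (ler_norm M))// lerDl.
Qed.

End sigma.

Section approximation.
Context {d : measure_display} {T : measurableType d} {R : realType}.
Implicit Types (G : set (set T)) (f g : T -> R) (A B : set T).

(* Rounding down to the grid [a + N / n.+1]; for [x < a] it takes the junk value [a]. *)
Definition grid (a : R) (n : nat) (x : R) : R :=
  a + (Num.truncn ((x - a) * n.+1%:R))%:R / n.+1%:R.

Lemma grid_bounds a n x : a <= x -> a <= grid a n x /\ x - n.+1%:R^-1 <= grid a n x <= x.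
Proof.
move=> ax; rewrite /grid.
have n0 : 0 < n.+1%:R :> R by rewrite ltr0n.
have xa0 : 0 <= (x - a) * n.+1%:R by rewrite mulr_ge0 ?subr_ge0// ltW.
have /andP[h1 h2] := truncn_itv xa0.
split; first by rewrite lerDl divr_ge0// ltW.
apply/andP; split; last by rewrite -lerBrDl ler_pdivrMr.
rewrite -lerBlDl ler_pdivlMr//.
have -> : (x - n.+1%:R^-1 - a) * n.+1%:R = (x - a) * n.+1%:R - 1.
  by rewrite mulrBl mulrBl mulVf ?gt_eqF// mulrBl; lra.
by rewrite lerBlDr natr1 ltW.
Qed.

Lemma grid_cvg a x : a <= x -> grid a n x @[n --> \oo] --> x.
Proof.
move=> ax; apply: (@squeeze_cvgr _ _ _ _ (fun n => x - harmonic n) (cst x)).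
- by near=> n; rewrite /harmonic/=; case: (grid_bounds n ax).
- rewrite -[X in _ --> X]subr0; apply: cvgB; first exact: cvg_cst.
  exact: cvg_harmonic.
- exact: cvg_cst.
Unshelve. all: by end_near. Qed.

Lemma grid_nd a n : nondecreasing_fun (grid a n).
Proof.
move=> x y xy; rewrite /grid lerD2l ler_pM2r ?invr_gt0 ?ltr0n// ler_nat.
by apply: le_truncn; rewrite ler_pM2r ?ltr0n// lerB.
Qed.

(** Makes [grid a n \o f] a simple function when [f] is bounded above: the truncations are naturals
    at most [K]. *)
Lemma grid_range a n M : exists s : seq R, forall x, x <= M -> grid a n x \in s.
Proof.
pose K := Num.truncn ((M - a) * n.+1%:R).
exists [seq a + i%:R / n.+1%:R | i <- iota 0 K.+1] => x xM.
apply/mapP; exists (Num.truncn ((x - a) * n.+1%:R)) => //.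
rewrite mem_iota add0n leq0n ltnS; apply: le_truncn.
by rewrite ler_pM2r ?ltr0n// lerB.
Qed.

Lemma Linf_rep_grid G a n f : sub_sigma G -> (forall w, a <= f w) ->
  Linf_rep G f -> Linf_rep G (grid a n \o f).
Proof.
move=> sG af [mf [M fM]]; split.
  have : measurable_fun setT (grid a n).
    by apply: nondecreasing_measurable => //; exact: grid_nd.
  move=> mg B mB; rewrite comp_preimage; apply: mf.
  by have := mg measurableT B mB; rewrite setTI.
exists (`|a| + M) => w /=.
have [h1 /andP[_ h2]] := grid_bounds n (af w).
have h3 := fM w; rewrite ler_norml; apply/andP; split.
  rewrite lerNl (le_trans (_ : _ <= - a))//; first by rewrite lerN2.
  rewrite (le_trans (ler_norm _))// normrN lerDl (le_trans _ h3)//.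
by rewrite (le_trans h2)// (le_trans (ler_norm _))// (le_trans h3)// lerDr.
Qed.

End approximation.

(** * Intermediate values under a non-atomic probability *)

Section cvg_compare.
Context {R : realType}.

Lemma cvg_le_bound (u : nat -> R) (l c : R) :
  u n @[n --> \oo] --> l -> (forall n, u n <= c) -> l <= c.
Proof.
move=> ul uc; rewrite leNgt; apply/negP => cl.
near \oo => n; have : c < u n by near: n; exact: (cvgr_gt _ ul).
by rewrite ltNge uc.
Unshelve. all: by end_near. Qed.

Lemma cvg_ge_bound (u : nat -> R) (l c : R) :
  u n @[n --> \oo] --> l -> (forall n, c <= u n) -> c <= l.
Proof.
move=> ul uc; rewrite leNgt; apply/negP => cl.
near \oo => n; have : u n < c by near: n; exact: (cvgr_lt _ ul).
by rewrite ltNge uc.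
Unshelve. all: by end_near. Qed.

Lemma cvg_le_cvg (u v : nat -> R) (k l : R) :
  u n @[n --> \oo] --> k -> v n @[n --> \oo] --> l -> (forall n, u n <= v n) -> k <= l.
Proof.
move=> uk vl uv; rewrite -subr_ge0.
apply: (@cvg_ge_bound (fun n => v n - u n)); first exact: cvgB.
by move=> n; rewrite subr_ge0.
Qed.

Lemma cvg_uniq_lim (u : nat -> R) (k l : R) :
  u n @[n --> \oo] --> k -> u n @[n --> \oo] --> l -> k = l.
Proof. by move=> uk ul; apply/eqP; rewrite eq_le !(cvg_le_cvg uk ul, cvg_le_cvg ul uk). Qed.

Lemma cvg_div_pow2 (c : R) : c / 2 ^+ n @[n --> \oo] --> (0 : R).
Proof.
rewrite -[X in _ --> X](mulr0 c); apply: cvgM; first exact: cvg_cst.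
have -> : (fun n => (2 ^+ n)^-1 : R) = (fun n => 2^-1 ^+ n).
  by apply/funext => n; rewrite exprVn.
by apply: cvg_expr; rewrite ger0_norm ?invf_lt1 ?ltr1n ?invr_ge0.
Qed.

(** Every dyadic estimate below ends here: level [n] gives the inequality up to a multiple of
    [1 / 2 ^+ n]. *)
Lemma le_pow2_approx (c x y : R) : (forall n, x <= y + c / 2 ^+ n) -> x <= y.
Proof.
move=> h; apply: (cvg_ge_bound _ h).
by rewrite -[X in _ --> X]addr0; apply: cvgD; [exact: cvg_cst|exact: cvg_div_pow2].
Qed.

End cvg_compare.

Section nonatomic.
Context {d : measure_display} {T : measurableType d} {R : realType}.
Variable P : probability T R.
Implicit Types (A B C H K : set T).

Definition pr A : R := fine (P A).

Lemma prE A : measurable A -> P A = (pr A)%:E.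
Proof. by move=> mA; rewrite /pr fineK// fin_num_measure. Qed.

Lemma pr_ge0 A : 0 <= pr A. Proof. by rewrite fine_ge0. Qed.

Lemma pr_gt0 A : measurable A -> (0 < P A)%E = (0 < pr A).
Proof. by move=> mA; rewrite prE. Qed.

Lemma pr_le A B : measurable A -> measurable B -> A `<=` B -> pr A <= pr B.
Proof. by move=> mA mB AB; rewrite -lee_fin -!prE// le_measure ?inE. Qed.

Lemma prU A B : measurable A -> measurable B -> [disjoint A & B] ->
  pr (A `|` B) = pr A + pr B.
Proof.
move=> mA mB AB; apply: EFin_inj; rewrite EFinD -!prE//; last exact: measurableU.
by rewrite measureU//; apply/eqP.
Qed.

Lemma pr_negligible A : measurable A -> pr A = 0 -> P.-negligible A.
Proof. by move=> mA A0; exists A; split => //; rewrite prE// A0. Qed.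

Lemma pr_neq0 A : measurable A -> P A != 0%E -> 0 < pr A.
Proof. by move=> mA A0; rewrite -pr_gt0// lt0e A0 measure_ge0. Qed.

Lemma pr_cvg_bigcup (F : nat -> set T) : (forall n, measurable (F n)) ->
  nondecreasing_seq F -> pr (F n) @[n --> \oo] --> pr (\bigcup_n F n).
Proof.
move=> mF ndF; apply: fine_cvg; rewrite -prE; last exact: bigcupT_measurable.
by apply: nondecreasing_cvg_mu => //; exact: bigcupT_measurable.
Qed.

(** Convergence of sets is a.e. convergence of indicators, the form in which continuity of a
    functional on acts passes to set functions. It covers monotone limits and changes on null
    sets. *)
Definition set_continuous (g : set T -> R) :=
  forall (S : nat -> set T) S0, (forall n, measurable (S n)) -> measurable S0 ->
  {ae P, forall w, \forall n \near \oo, S n w <-> S0 w} ->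
  g (S n) @[n --> \oo] --> g S0.

Lemma set_continuous_bigcup g (S : nat -> set T) : set_continuous g ->
  (forall n, measurable (S n)) -> nondecreasing_seq S ->
  g (S n) @[n --> \oo] --> g (\bigcup_n S n).
Proof.
move=> cg mS ndS; apply: cg => //; first exact: bigcupT_measurable.
apply: aeW => w; have [[n _ Snw]|nS] := pselect ((\bigcup_n S n) w).
  near=> m; split; [by exists m|move=> _].
  have /subsetPset : (S n <= S m)%O by apply: ndS; near: m; exact: nbhs_infty_ge.
  exact.
by near=> m; split => // Smw; case: nS; exists m.
Unshelve. all: by end_near. Qed.

Lemma set_continuous_ae g A B : set_continuous g -> measurable A -> measurable B ->
  {ae P, forall w, A w <-> B w} -> g A = g B.
Proof.
move=> cg mA mB AB; apply: (@cvg_uniq_lim _ (fun=> g A)); first exact: cvg_cst.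
apply: cg => //; apply: filterS AB => w AB; near=> n; exact: AB.
Unshelve. all: by end_near. Qed.

Hypothesis naP : nonatomic P.

(** Non-atomicity gives a proper part [B]; one of [B] and [A \ B] has at most half the mass. *)
Lemma exists_small_subset A : measurable A -> 0 < pr A ->
  exists B, [/\ measurable B, B `<=` A, 0 < pr B & pr B <= pr A / 2].
Proof.
move=> mA A0; have := naP mA; rewrite pr_gt0// => /(_ A0)[B [mB BA B0 BltA]].
move: B0 BltA; rewrite !prE// !lte_fin => B0 BltA.
have mD : measurable (A `\` B) by exact: measurableD.
have AE : pr A = pr B + pr (A `\` B).
  by rewrite -prU ?setDUK//; apply/disj_setPS; rewrite setDE setICA setICr setI0.
have [h|h] := leP (pr B) (pr A / 2); first by exists B.
exists (A `\` B); split; [exact: mD|exact: subDsetl|lra|lra].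
Qed.

Lemma exists_vanishing_subsets A : measurable A -> 0 < pr A ->
  exists C : nat -> set T, (forall n, [/\ measurable (C n), C n `<=` A & 0 < pr (C n)])
    /\ {ae P, forall w, \forall n \near \oo, ~ C n w}.
Proof.
move=> mA A0.
have /choice[h hP] : forall B, exists B', measurable B -> 0 < pr B ->
    [/\ measurable B', B' `<=` B, 0 < pr B' & pr B' <= pr B / 2].
  move=> B; have [[mB B0]|nB] := pselect (measurable B /\ 0 < pr B).
    by have [B' ?] := exists_small_subset mB B0; exists B'.
  by exists B => mB B0; case: nB.
pose C n := iter n h A.
have CP n : [/\ measurable (C n), C n `<=` A, 0 < pr (C n) & pr (C n) <= pr A / 2 ^+ n].
  elim: n => [|n [mC CA C0 Cle]]; first by rewrite expr0 divr1; split.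
  have [? h2 ? h4] := hP _ mC C0; split => //; first exact: subset_trans h2 CA.
  apply: (le_trans h4); rewrite exprS invfM mulrA mulrAC ler_pM2r//.
have Cdec n : C n.+1 `<=` C n by have [mC _ C0 _] := CP n; case: (hP _ mC C0).
exists C; split; first by move=> n; case: (CP n).
have mCap : measurable (\bigcap_n C n) by apply: bigcapT_measurable => n; case: (CP n).
have CC m n : (m <= n)%N -> C n `<=` C m.
  by move=> /subnK <-; elim: (n - m)%N => // k IH; exact: subset_trans (Cdec _) IH.
exists (\bigcap_n C n); split => //.
  rewrite prE//; congr (_%:E); apply/eqP; rewrite eq_le pr_ge0 andbT.
  apply: (@cvg_ge_bound _ (fun n => pr A / 2 ^+ n)).
    exact: cvg_div_pow2.
  move=> n; have [mC _ _] := CP n; apply: le_trans.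
  by apply: pr_le => //; exact: bigcap_inf.
move=> w /= nw n _; apply: contrapT => nC; apply: nw.
near=> m => Cm; apply: nC; apply: (CC n m) => //.
by near: m; exact: nbhs_infty_ge.
Unshelve. all: by end_near. Qed.

(** Exhaustion: among subsets of [A] with [g <= 0], an increasing union [U] is built that cannot be
    enlarged in probability. If [g U] were negative, a small enough piece of [A \ U] could still be
    added. *)
Lemma set_ivt g A : set_continuous g -> measurable A -> g set0 <= 0 -> 0 <= g A ->
  exists H, [/\ measurable H, H `<=` A & g H = 0].
Proof.
move=> cg mA g0 gA.
pose L H := [/\ measurable H, H `<=` A & g H <= 0].
pose V H := [set pr K | K in [set K | L K /\ H `<=` K]].
have Vub H : has_ubound (V H).
  by exists (pr A) => _ [K [[mK KA _] _] <-]; exact: pr_le.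
(* The inequality says that [K] gains at least half of what can be gained over [H]. *)
have /choice[h hP] : forall H, exists K, L H ->
    [/\ L K, H `<=` K & sup (V H) <= 2 * pr K - pr H].
  move=> H; have [LH|nL] := pselect (L H); last by exists H.
  have VH : V H (pr H) by exists H => //; split.
  have [lt|ge] := ltP (pr H) (sup (V H)); last by exists H => _; split => //; lra.
  have hs : has_sup (V H) by split => //; exists (pr H).
  have e0 : 0 < (sup (V H) - pr H) / 2 by rewrite divr_gt0 ?subr_gt0.
  have [_ [K [LK HK] <-] ltK] := sup_adherent e0 hs.
  by exists K => _; split => //; lra.
pose F n := iter n h set0.
have LF n : L (F n).
  elim: n => [|n IH]; last by case: (hP _ IH).
  by split; [exact: measurable0|exact: sub0set|exact: g0].
have Fnd : nondecreasing_seq F.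
  apply/nondecreasing_seqP => n; apply/subsetPset.
  by have [_ + _] := hP _ (LF n).
have mF n : measurable (F n) by case: (LF n).
pose U := \bigcup_n F n.
have mU : measurable U by exact: bigcupT_measurable.
have LU : L U.
  split=> //; first by apply: bigcup_sub => n _; case: (LF n).
  apply: (@cvg_le_bound _ (fun n => g (F n))); first exact: set_continuous_bigcup.
  by move=> n; case: (LF n).
have prF := pr_cvg_bigcup mF Fnd.
(* Such a [K] competes at every stage, so [pr K <= 2 * pr (F n.+1) - pr (F n)], whose limit is
   [pr U]. *)
have Umax K : L K -> U `<=` K -> pr K <= pr U.
  move=> LK UK; apply: (@cvg_ge_bound _ (fun n => 2 * pr (F n.+1) - pr (F n))).
    have -> : pr U = 2 * pr U - pr U by lra.
    apply: cvgB => //; apply: cvgM; first exact: cvg_cst.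
    by rewrite (cvg_shiftS (fun n => pr (F n))).
  move=> n; have [_ _] := hP _ (LF n); apply: le_trans; apply: ub_le_sup => //.
  by exists K => //; split => //; apply: subset_trans UK; exact: bigcup_sup.
exists U; have [_ UA gU] := LU; split => //.
apply/eqP; rewrite eq_le gU/= leNgt; apply/negP => gU0.
have mD : measurable (A `\` U) by exact: measurableD.
(* With nothing left to add, [g A = g U < 0], against [0 <= g A]. *)
have [D0|D0] := eqVneq (P (A `\` U)) 0%E.
  have : g A = g U.
    apply: set_continuous_ae => //; exists (A `\` U); split => // w /= nw.
    apply: contrapT => h'; apply: nw; split=> [Aw|/UA//].
    by apply: contrapT => nU; exact: h'.
  by move=> gAU; move: gA; rewrite gAU leNgt gU0.
have [C [CP Cvan]] := exists_vanishing_subsets mD (pr_neq0 mD D0).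
have : g (U `|` C n) @[n --> \oo] --> g U.
  apply: cg => //; first by move=> n; apply: measurableU => //; case: (CP n).
  apply: filterS Cvan => w; apply: filterS => n nC; split => [[]//|]; by left.
move=> gUC.
near \oo => n.
have [mC CD C0] := CP n.
have gn : g (U `|` C n) <= 0.
  by apply: ltW; near: n; exact: (cvgr_lt _ gUC).
have dUC : [disjoint U & C n].
  by apply/disj_setPS => w [Uw /CD[]].
have : pr (U `|` C n) <= pr U.
  apply: Umax; last by left.
  split => //; first exact: measurableU.
  by move=> w [/UA//|/CD[]].
by rewrite prU// leNgt; rewrite ltrDl C0.
Unshelve. all: by end_near. Qed.

End nonatomic.

(** * Preferences satisfying the sure-thing principle *)

Section preference.
Context {d : measure_display} {T : measurableType d} {R : realType}.
Variable P : probability T R.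
Variable I : (T -> R) -> R.
Local Notation act := (@Linf_rep d T R (@Fsig d T)).

Definition dominated_continuous (J : (T -> R) -> R) :=
  forall (X : nat -> T -> R) f, (forall n, act (X n)) -> act f ->
    (exists M : R, forall n w, `|X n w| <= M) ->
    {ae P, forall w, X n w @[n --> \oo] --> f w} -> J (X n) @[n --> \oo] --> J f.

(** All that the scale construction uses of [E_0]. Conditioning has disappeared; its trace is
    [pref_sure_thing]. *)
Record preference : Prop := Preference {
  pref_ae : forall f g, act f -> act g -> aeeq P f g -> I f = I g;
  pref_cvg : dominated_continuous I;
  pref_lt : forall x y Z A, x < y -> act Z -> measurable A -> 0 < pr P A ->
    I (glue A (cst x) Z) < I (glue A (cst y) Z);
  pref_cst : forall c, I (cst c) = c;
  pref_sure_thing : forall A X X' Z Z', measurable A ->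
    act X -> act X' -> act Z -> act Z' ->
    I (glue A X Z) <= I (glue A X' Z) -> I (glue A X Z') <= I (glue A X' Z') }.

Hypothesis prefI : preference.

Lemma act_cst c : act (cst c). Proof. exact: Linf_rep_cst sub_sigmaF c. Qed.

Lemma act_glue A f g : measurable A -> act f -> act g -> act (glue A f g).
Proof. by move=> mA af ag; exact: (Linf_rep_glue sub_sigmaF). Qed.

Local Hint Resolve act_cst act_glue : core.

Lemma act_fiber f x : act f -> measurable [set w | f w = x].
Proof. by move=> [mf _]; exact: (mf [set x] (measurable_set1 x)). Qed.

Lemma pref_sure_thing_eq A X X' Z Z' : measurable A ->
    act X -> act X' -> act Z -> act Z' ->
    I (glue A X Z) = I (glue A X' Z) -> I (glue A X Z') = I (glue A X' Z').
Proof.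
move=> mA aX aX' aZ aZ' e; apply/eqP; rewrite eq_le; apply/andP; split.
  by apply: (@pref_sure_thing prefI _ _ _ Z) => //; rewrite e.
by apply: (@pref_sure_thing prefI _ _ _ Z) => //; rewrite e.
Qed.

Lemma pref_null A f g : measurable A -> act f -> act g -> pr P A = 0 ->
  I (glue A f g) = I g.
Proof.
move=> mA af ag A0; apply: (pref_ae prefI) => //; first exact: act_glue.
have [N [mN N0 AN]] := pr_negligible mA A0.
exists N; split => // w /= h; apply: AN.
by apply: contrapT => nA; apply: h; rewrite glueF.
Qed.

Lemma pref_le_cst x y Z A : x <= y -> act Z -> measurable A ->
  I (glue A (cst x) Z) <= I (glue A (cst y) Z).
Proof.
move=> xy aZ mA; have [A0|A0] := eqVneq (P A) 0%E.
  by rewrite !pref_null//; rewrite /pr A0.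
move: xy; rewrite le_eqVlt => /predU1P[->//|xy].
by apply: ltW; apply: (pref_lt prefI) => //; exact: pr_neq0.
Qed.

(** Induction on the list of values: the fibre [A1] of the first one is handled by [pref_le_cst],
    the rest [A2] by induction. [Z] is generalised because the value on [A1] becomes part of the
    background. *)
Lemma pref_between_simple a b (s : seq R) A X Z : measurable A -> act X -> act Z ->
  (forall w, A w -> X w \in s) -> (forall w, A w -> a <= X w <= b) ->
  I (glue A (cst a) Z) <= I (glue A X Z) <= I (glue A (cst b) Z).
Proof.
elim: s A Z => [|x s IH] A Z mA aX aZ Xs Xab.
  have A0 w : ~ A w by move=> /Xs.
  have E Y : glue A Y Z = Z by apply/funext => w; rewrite glueF.
  by rewrite !E lexx.
pose A1 := A `&` [set w | X w = x]; pose A2 := A `\` [set w | X w = x].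
have mA1 : measurable A1 by apply: measurableI => //; exact: act_fiber.
have mA2 : measurable A2 by apply: measurableD => //; exact: act_fiber.
have E Y : glue A Y Z = glue A1 Y (glue A2 Y Z).
  apply/funext => w; rewrite /glue /A1 /A2 in_setI in_setD.
  by case: (w \in A) => //=; case: (w \in [set w | X w = x]).
have Ec c Y : glue A1 (cst c) (glue A2 Y Z) = glue A2 Y (glue A1 (cst c) Z).
  apply/funext => w; rewrite /glue /A1 /A2 in_setI in_setD.
  by case: (w \in A) => //=; case: (w \in [set w | X w = x]).
have EX : glue A X Z = glue A1 (cst x) (glue A2 X Z).
  by rewrite E; apply: glue_eq => // w [_ /=].
(* If [x] is not attained on [A], it may lie outside [[a, b]], so this case is treated apart. *)
have [[w0 [Aw0 /= Xw0]]|nA1] := pselect (exists w, A1 w); last first.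
  have E1 Y Y' : glue A1 Y Y' = Y'.
    by apply/funext => w; rewrite glueF// => A1w; apply: nA1; exists w.
  rewrite !E !E1; apply: IH => // [w [Aw /= nx]|w [Aw _]]; last exact: Xab.
  by have := Xs _ Aw; rewrite inE => /predU1P[|].
have /andP[ax xb] : a <= x <= b by rewrite -Xw0; exact: Xab.
have IH' c : I (glue A2 (cst a) (glue A1 (cst c) Z)) <=
    I (glue A2 X (glue A1 (cst c) Z)) <= I (glue A2 (cst b) (glue A1 (cst c) Z)).
  apply: IH => // [|w [Aw /= nx]|w [Aw _]]; [exact: act_glue| |exact: Xab].
  by have := Xs _ Aw; rewrite inE => /predU1P[|].
rewrite EX; apply/andP; split.
  apply: (@le_trans _ _ (I (glue A1 (cst a) (glue A2 X Z)))); last first.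
    by apply: pref_le_cst => //; exact: act_glue.
  by rewrite E !Ec; case/andP: (IH' a).
apply: (@le_trans _ _ (I (glue A1 (cst b) (glue A2 X Z)))).
  by apply: pref_le_cst => //; exact: act_glue.
by rewrite E !Ec; case/andP: (IH' b).
Qed.

Lemma pref_between a b A X Z : measurable A -> act X -> act Z ->
  (forall w, A w -> a <= X w <= b) ->
  I (glue A (cst a) Z) <= I (glue A X Z) <= I (glue A (cst b) Z).
Proof.
move=> mA aX aZ Xab.
(* Off [A] the act [X] may drop below [a], where [grid] no longer approximates; [X'] agrees with [X]
   on [A] and is at least [a] everywhere. *)
pose X' := glue A X (cst a).
have aX' : act X' by exact: act_glue.
have aleX' w : a <= X' w.
  by rewrite /X'; have [Aw|nAw] := pselect (A w);
    [rewrite glueT//; case/andP: (Xab _ Aw)|rewrite glueF].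
have [M M0 X'M] := Linf_rep_pos aX'.
have [N N0 ZN] := Linf_rep_pos aZ.
have Xlim : I (glue A (grid a n \o X') Z) @[n --> \oo] --> I (glue A X Z).
  apply: (pref_cvg prefI) => //.
  - by move=> n; apply: act_glue => //; apply: Linf_rep_grid => //; exact: sub_sigmaF.
  - exact: act_glue.
  - exists (Num.max (`|a| + M) N) => n w; rewrite le_max.
    have [Aw|nAw] := pselect (A w); last by rewrite glueF// ZN orbT.
    rewrite glueT//=; apply/orP; left.
    have [h1 /andP[_ h2]] := grid_bounds n (aleX' w).
    rewrite ler_norml; apply/andP; split.
      rewrite lerNl (le_trans (_ : _ <= - a)) ?lerN2//.
      by rewrite (le_trans (ler_norm _))// normrN lerDl ltW.
    rewrite (le_trans h2)// (le_trans (ler_norm _))// (le_trans (X'M w))//.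
    by rewrite lerDr.
  - apply: aeW => w; have [Aw|nAw] := pselect (A w).
      rewrite glueT// (_ : (fun n => _) = (fun n => grid a n (X' w))); last first.
        by apply/funext => n; rewrite glueT.
      rewrite (_ : X w = X' w); last by rewrite /X' glueT.
      exact: grid_cvg.
    rewrite glueF// (_ : (fun n => _) = (fun n => Z w)); first exact: cvg_cst.
    by apply/funext => n; rewrite glueF.
have bnd n : I (glue A (cst a) Z) <= I (glue A (grid a n \o X') Z) <= I (glue A (cst b) Z).
  have [s sP] := grid_range a n M.
  apply: (@pref_between_simple _ _ s) => //.
  - by apply: Linf_rep_grid => //; exact: sub_sigmaF.
  - move=> w _ /=; apply: sP; exact: le_trans (ler_norm _) (X'M w).
  - move=> w Aw /=; have [-> /andP[_ h2]] := grid_bounds n (aleX' w).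
    by rewrite (le_trans h2)// /X' glueT//; case/andP: (Xab _ Aw).
apply/andP; split.
  by apply: (cvg_ge_bound Xlim) => n; case/andP: (bnd n).
by apply: (cvg_le_bound Xlim) => n; case/andP: (bnd n).
Qed.

Lemma glue_set_continuous J f g : dominated_continuous J -> act f -> act g ->
  set_continuous P (fun S => J (glue S f g)).
Proof.
move=> cJ af ag S S0 mS mS0 SS0.
have [M M0 fM] := Linf_rep_pos af.
have [N N0 gN] := Linf_rep_pos ag.
apply: cJ.
- by move=> n; exact: act_glue.
- exact: act_glue.
- exists (Num.max M N) => n w; rewrite le_max /glue; case: ifP => _.
    by rewrite fM.
  by rewrite gN orbT.
- apply: filterS SS0 => w Sw; apply: cvg_near_cst.
  apply: filterS Sw => n Sn; have [S0w|nS0] := pselect (S0 w).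
    by rewrite !glueT//; apply/Sn.
  by rewrite !glueF// => /Sn.
Qed.

Lemma set_continuous_cst (c : R) : set_continuous P (fun=> c).
Proof. by move=> S S0 _ _ _; exact: cvg_cst. Qed.

Lemma set_continuousB g h : set_continuous P g -> set_continuous P h ->
  set_continuous P (fun S => g S - h S).
Proof. by move=> cg ch S S0 mS mS0 SS0; apply: cvgB; [exact: cg|exact: ch]. Qed.

Lemma set_continuousD A g : measurable A -> set_continuous P g ->
  set_continuous P (fun S => g (A `\` S)).
Proof.
move=> mA cg S S0 mS mS0 SS0; apply: cg.
- by move=> n; exact: measurableD.
- exact: measurableD.
- by apply: filterS SS0 => w; apply: filterS => n e; split => -[Aw nS]; split => // /e.
Qed.

Lemma set_continuousU A g : measurable A -> set_continuous P g ->
  set_continuous P (fun S => g (A `|` S)).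
Proof.
move=> mA cg S S0 mS mS0 SS0; apply: cg.
- by move=> n; exact: measurableU.
- exact: measurableU.
- apply: filterS SS0 => w; apply: filterS => n e.
  by split => -[Aw|/e Sw]; [left|right|left|right].
Qed.

End preference.
#[local] Hint Resolve act_cst act_glue : core.

(** * Dyadic subdivision of a qualitative probability *)

Section bets.
Context {d : measure_display} {T : measurableType d} {R : realType}.
Variable P : probability T R.
Variable I : (T -> R) -> R.
Hypothesis prefI : preference P I.
Variables a b : R.
Hypothesis ab : a < b.
Implicit Types S B C A : set T.

Definition bet S := I (glue S (cst b) (cst a)).

Lemma bet0 : bet set0 = a.
Proof.
rewrite /bet (_ : glue _ _ _ = cst a); first exact: (pref_cst prefI).
by apply/funext => w; rewrite glueF.
Qed.

Lemma betT : bet setT = b.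
Proof.
rewrite /bet (_ : glue _ _ _ = cst b); first exact: (pref_cst prefI).
by apply/funext => w; rewrite glueT.
Qed.

Lemma bet_cont : set_continuous P bet.
Proof. by apply: glue_set_continuous => //; exact: (pref_cvg prefI). Qed.

Lemma bet_leE S S' C : measurable S -> measurable S' -> measurable C ->
  C `&` S `<=` set0 -> C `&` S' `<=` set0 ->
  (bet S <= bet S') = (bet (S `|` C) <= bet (S' `|` C)).
Proof.
move=> mS mS' mC CS CS'.
have Ea U : C `&` U `<=` set0 ->
    glue U (cst b) (cst a) = glue (~` C) (glue U (cst b) (cst a)) (cst a).
  move=> CU; apply/funext => w; rewrite glueC; have [Cw|nC] := pselect (C w).
    by rewrite [RHS]glueT// glueF// => Uw; exact: (CU w).
  by rewrite [RHS]glueF.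
have Eb U : glue (U `|` C) (cst b) (cst a) = glue (~` C) (glue U (cst b) (cst a)) (cst b).
  apply/funext => w; rewrite glueC; have [Cw|nC] := pselect (C w).
    by rewrite [RHS]glueT// glueT//; right.
  rewrite [RHS]glueF//; have [Uw|nU] := pselect (U w).
    by rewrite !glueT//; left.
  by rewrite !glueF// => -[].
have mCC : measurable (~` C) by exact: measurableC.
rewrite /bet !Eb {1}(Ea S)// {1}(Ea S')//.
apply/idP/idP; apply: (pref_sure_thing prefI); do ?[exact: act_glue|exact: act_cst|by[]].
Qed.

Lemma bet_le S S' : measurable S -> measurable S' -> S `<=` S' -> bet S <= bet S'.
Proof.
move=> mS mS' SS'; have mD : measurable (S' `\` S) by exact: measurableD.
have E c : glue (S' `\` S) (cst c) (glue S (cst b) (cst a)) =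
    glue S (cst b) (glue S' (cst c) (cst a)).
  apply/funext => w; rewrite /glue in_setD.
  by case: (w \in S') => //=; case: (w \in S).
rewrite /bet (_ : glue S _ _ = glue (S' `\` S) (cst a) (glue S (cst b) (cst a))).
  rewrite (_ : glue S' _ _ = glue (S' `\` S) (cst b) (glue S (cst b) (cst a))).
    by apply: (pref_le_cst prefI) => //; [exact: ltW|exact: act_glue].
  rewrite E; apply/funext => w; have [Sw|nS] := pselect (S w).
    by rewrite [RHS]glueT// glueT//; exact: SS'.
  by rewrite [RHS]glueF.
by rewrite E glue_id.
Qed.

Lemma bet_null S : measurable S -> bet S = a -> pr P S = 0.
Proof.
move=> mS Sa; apply/eqP; have [//|S0] := eqVneq (P S) 0%E.
  by rewrite /pr => ->.
have := pref_lt prefI ab (act_cst a) mS (pr_neq0 mS S0).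
by rewrite glue_id (pref_cst prefI) -/(bet S) Sa ltxx.
Qed.

Lemma bet_add_le S S' B B' : measurable S -> measurable S' -> measurable B ->
  measurable B' -> S `&` S' `<=` set0 -> B `&` B' `<=` set0 ->
  bet S <= bet B -> bet S' <= bet B' -> bet (S `|` S') <= bet (B `|` B').
Proof.
move=> mS mS' mB mB' SS' BB' SB SB'.
have mSB : measurable (S' `\` B) by exact: measurableD.
have mBS : measurable (B `\` S') by exact: measurableD.
have mI : measurable (S' `&` B) by exact: measurableI.
have h1 : bet (S `|` (S' `\` B)) <= bet (S' `|` (B `\` S')).
  rewrite [X in _ <= bet X](_ : _ = B `|` (S' `\` B)).
    rewrite -bet_leE// => w [[S'w nB]]; last by move=> /nB.
    by move=> Sw; apply: (SS' w).
  by apply/seteqP; split => w /=; have [?|?] := pselect (B w);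
    have [?|?] := pselect (S' w); tauto.
have h2 : bet (S' `|` (B `\` S')) <= bet (B' `|` (B `\` S')).
  rewrite -bet_leE// => w [[Bw nS]]; first by move=> /nS.
  by move=> B'w; apply: (BB' w).
have := le_trans h1 h2; rewrite (@bet_leE _ _ (S' `&` B)) => //.
- by congr (bet _ <= bet _); apply/seteqP; split => w /=; have [?|?] := pselect (B w);
    have [?|?] := pselect (S' w); tauto.
- exact: measurableU.
- exact: measurableU.
- move=> w [[S'w Bw] [Sw|[_ nB]]]; [by apply: (SS' w)|exact: nB].
- move=> w [[S'w Bw] [B'w|[_ nS]]]; [by apply: (BB' w)|exact: nS].
Qed.

Lemma bet_add_lt S S' B B' : measurable S -> measurable S' -> measurable B ->
  measurable B' -> S `&` S' `<=` set0 -> B `&` B' `<=` set0 ->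
  bet S < bet B -> bet S' <= bet B' -> bet (S `|` S') < bet (B `|` B').
Proof.
move=> mS mS' mB mB' SS' BB' SB SB'.
have mSB : measurable (S' `\` B) by exact: measurableD.
have mBS : measurable (B `\` S') by exact: measurableD.
have mI : measurable (S' `&` B) by exact: measurableI.
have h1 : bet (S `|` (S' `\` B)) < bet (S' `|` (B `\` S')).
  rewrite [X in _ < bet X](_ : _ = B `|` (S' `\` B)).
    rewrite ltNge -bet_leE// -?ltNge// => w [[S'w nB]]; first by move=> /nB.
    by move=> Sw; apply: (SS' w).
  by apply/seteqP; split => w /=; have [?|?] := pselect (B w);
    have [?|?] := pselect (S' w); tauto.
have h2 : bet (S' `|` (B `\` S')) <= bet (B' `|` (B `\` S')).
  rewrite -bet_leE// => w [[Bw nS]]; first by move=> /nS.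
  by move=> B'w; apply: (BB' w).
have := lt_le_trans h1 h2; rewrite !ltNge (@bet_leE _ _ (S' `&` B)) => //.
- by congr (~~ (bet _ <= bet _)); apply/seteqP; split => w /=; have [?|?] := pselect (B w);
    have [?|?] := pselect (S' w); tauto.
- exact: measurableU.
- exact: measurableU.
- move=> w [[S'w Bw] [B'w|[_ nS]]]; [by apply: (BB' w)|exact: nS].
- move=> w [[S'w Bw] [Sw|[_ nB]]]; [by apply: (SS' w)|exact: nB].
Qed.

Lemma bet_add_eq S S' B B' : measurable S -> measurable S' -> measurable B ->
  measurable B' -> S `&` S' `<=` set0 -> B `&` B' `<=` set0 ->
  bet S = bet B -> bet S' = bet B' -> bet (S `|` S') = bet (B `|` B').
Proof.
move=> mS mS' mB mB' SS' BB' SB SB'; apply/eqP; rewrite eq_le.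
by rewrite !bet_add_le// ?SB ?SB'.
Qed.

Hypothesis naP : nonatomic P.

Lemma bet_ivt A c : measurable A -> a <= c -> c <= bet A ->
  exists S, [/\ measurable S, S `<=` A & bet S = c].
Proof.
move=> mA ac cA.
have cg : set_continuous P (fun S => bet S - c).
  by apply: set_continuousB; [exact: bet_cont|exact: set_continuous_cst].
have [||S [mS SA Sc]] := set_ivt naP cg mA.
- by rewrite bet0 subr_le0.
- by rewrite subr_ge0.
by exists S; split => //; apply/eqP; rewrite -subr_eq0 Sc.
Qed.

(** [bet S - bet (A \ S)] is at most zero at [set0] and at least zero at [A]. *)
Lemma bet_half_ex A : measurable A ->
  exists S, [/\ measurable S, S `<=` A & bet S = bet (A `\` S)].
Proof.
move=> mA.
have cg : set_continuous P (fun S => bet S - bet (A `\` S)).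
  by apply: set_continuousB; [exact: bet_cont|apply: set_continuousD => //; exact: bet_cont].
have [||S [mS SA Sc]] := set_ivt naP cg mA.
- by rewrite setD0 subr_le0; apply: bet_le.
- by rewrite setDv subr_ge0; apply: bet_le.
by exists S; split => //; apply/eqP; rewrite -subr_eq0 Sc.
Qed.

Definition half A : set T := xget set0
  [set S | measurable A -> [/\ measurable S, S `<=` A & bet S = bet (A `\` S)]].

Lemma halfP A : measurable A ->
  [/\ measurable (half A), half A `<=` A & bet (half A) = bet (A `\` half A)].
Proof.
move=> mA; rewrite /half; case: xgetP => [S _ /(_ mA)//|nS].
by have [S hS] := bet_half_ex mA; case: (nS S).
Qed.

(* The [2 ^ n] cells of level [n]; cells of index [k >= 2 ^ n] are empty. *)
Fixpoint cell (n k : nat) : set T :=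
  if n is n'.+1 then
    if odd k then cell n' k./2 `\` half (cell n' k./2) else half (cell n' k./2)
  else if k is 0 then setT else set0.

Lemma cell_measurable n k : measurable (cell n k).
Proof.
elim: n k => [|n IH] k /=; first by case: k.
have [? _ _] := halfP (IH k./2).
by case: ifP => // _; exact: measurableD.
Qed.
Local Hint Resolve cell_measurable : core.

Lemma cell_sub n k : cell n.+1 k `<=` cell n k./2.
Proof.
move=> w /=; have [_ h _] := halfP (cell_measurable n k./2).
by case: ifP => _; [case|exact: h].
Qed.

Lemma cell_split n k : cell n k = cell n.+1 k.*2 `|` cell n.+1 k.*2.+1.
Proof.
rewrite /= odd_double /= uphalf_double half_double.
have [_ h _] := halfP (cell_measurable n k).
by rewrite setDUK.
Qed.

Lemma cell_disj n j k : j != k -> cell n j `&` cell n k `<=` set0.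
Proof.
elim: n j k => [|n IH] j k jk w; first by case: j k jk => [|j] [|k] //= _ [].
move=> [wj wk]; have [e|ne] := eqVneq j./2 k./2; last first.
  by apply: (IH _ _ ne w); split; [exact: cell_sub wj|exact: cell_sub wk].
move: wj wk; rewrite /= e; have [oj|oj] := boolP (odd j); have [ok|ok] := boolP (odd k).
- by move: jk; rewrite -(odd_double_half j) -(odd_double_half k) e oj ok eqxx.
- by move=> [_ nh] /nh.
- by move=> + [_ nh] => /nh.
- move: jk; rewrite -(odd_double_half j) -(odd_double_half k) e.
  by rewrite (negbTE oj) (negbTE ok) eqxx.
Qed.

(** Both halves of a cell tie. If the halves of one cell outranked those of another, additivity
    would rank the parents strictly, against the induction hypothesis. *)
Lemma bet_cell n j k : (j < 2 ^ n)%N -> (k < 2 ^ n)%N -> bet (cell n j) = bet (cell n k).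
Proof.
elim: n j k => [|n IH] j k; first by rewrite !ltnS !leqn0 => /eqP-> /eqP->.
suff even i i' : (i < 2 ^ n)%N -> (i' < 2 ^ n)%N ->
    bet (half (cell n i)) <= bet (half (cell n i')).
  have bE i : bet (cell n.+1 i) = bet (half (cell n i./2)).
    by rewrite /=; case: ifP => // _; case: (halfP (cell_measurable n i./2)).
  rewrite expnS mul2n => hj hk; rewrite !bE; apply/eqP; rewrite eq_le.
  by rewrite !even// ltn_half_double.
move=> hi hi'; rewrite leNgt; apply/negP => lt.
have [m1 s1 e1] := halfP (cell_measurable n i).
have [m2 s2 e2] := halfP (cell_measurable n i').
have : bet (cell n i') < bet (cell n i).
  rewrite -(setDUK s1) -(setDUK s2); apply: bet_add_lt => //.
  - exact: measurableD.
  - exact: measurableD.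
  - by move=> w [? []].
  - by move=> w [? []].
  - by rewrite -e1 -e2 ltW.
by rewrite (IH _ _ hi hi') ltxx.
Qed.

(** Were a half no better than [set0], so would be the other, and by additivity their union, the
    parent cell. *)
Lemma bet_cell_gt n k : (k < 2 ^ n)%N -> a < bet (cell n k).
Proof.
elim: n k => [|n IH] k; first by rewrite ltnS leqn0 => /eqP-> /=; rewrite betT.
rewrite expnS mul2n => hk; have := IH k./2; rewrite ltn_half_double => /(_ hk) lt.
have [m1 s1 e1] := halfP (cell_measurable n k./2).
have bE : bet (cell n.+1 k) = bet (half (cell n k./2)) by rewrite /=; case: ifP.
rewrite bE ltNge; apply/negP => le.
move: lt; rewrite ltNge -bet0 -(setDUK s1) -(setU0 set0) => /negP; apply.
apply: bet_add_le => //.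
- exact: measurableD.
- by move=> w [? []].
- by rewrite bet0.
- by rewrite -e1 bet0.
Qed.

(** The yardstick: [bet (block n 0 k)] will be the point of scale value [k / 2 ^ n]. *)
Definition block n i k : set T := [set w | exists2 j, (i <= j < k)%N & cell n j w].

Lemma blockE n i : block n i i = set0.
Proof. by apply/seteqP; split => // w [j /andP[h1 h2]]; move: (leq_ltn_trans h1 h2); rewrite ltnn. Qed.

Lemma block_cat n i k m : (i <= k)%N -> (k <= m)%N -> block n i m = block n i k `|` block n k m.
Proof.
move=> ik km; apply/seteqP; split => w /=.
  move=> [j /andP[ij jm] cj]; have [jk|kj] := ltnP j k.
    by left; exists j => //; rewrite ij.
  by right; exists j => //; rewrite kj.
move=> [[j /andP[ij jk] cj]|[j /andP[kj jm] cj]].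
  by exists j => //; rewrite ij (leq_trans jk).
by exists j => //; rewrite (leq_trans ik).
Qed.

Lemma block1 n i : block n i i.+1 = cell n i.
Proof.
apply/seteqP; split => w /=; last by exists i; rewrite // leqnn ltnS leqnn.
by move=> [j]; rewrite ltnS -eqn_leq => /eqP->.
Qed.

Lemma block_measurable n i k : measurable (block n i k).
Proof.
have [ki|/ltnW] := leqP k i.
  rewrite (_ : block n i k = set0)//; apply/seteqP; split=> // w [j /andP[h1 h2]].
  by have := leq_ltn_trans h1 (leq_trans h2 ki); rewrite ltnn.
move=> /subnK <-; elim: (k - i)%N => [|m IH]; first by rewrite add0n blockE.
rewrite addSn (@block_cat _ _ (m + i)%N) ?leq_addl// block1.
exact: measurableU.
Qed.
Local Hint Resolve block_measurable : core.

Lemma block_disj n i k m : block n i k `&` block n k m `<=` set0.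
Proof.
move=> w [[j /andP[_ jk] wj] [l /andP[kl _] wl]].
apply: (@cell_disj n j l _ w) => //; by rewrite neq_ltn (leq_trans jk kl).
Qed.

Lemma block_double n i k : block n.+1 i.*2 k.*2 = block n i k.
Proof.
apply/seteqP; split => w /=.
  move=> [j /andP[ij jk] wj]; exists j./2; last exact: cell_sub wj.
  by rewrite geq_half_double ij ltn_half_double jk.
move=> [j /andP[ij jk]]; rewrite cell_split => -[wj|wj].
  by exists j.*2 => //; rewrite leq_double ij ltn_double.
by exists j.*2.+1 => //; rewrite leqW ?leq_double//= ltn_Sdouble.
Qed.

(** Allows blocks of different levels to be compared on a common refinement. *)
Lemma block_scale n m i k : block (m + n) (2 ^ m * i) (2 ^ m * k) = block n i k.
Proof.
elim: m => [|m IH]; first by rewrite !mul1n.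
by rewrite -IH addSn !expnS -!mulnA !mul2n block_double.
Qed.

Lemma block_full n : block n 0 (2 ^ n) = setT.
Proof.
have := block_scale 0 n 0 1; rewrite muln0 muln1 addn0 => ->.
by rewrite block1.
Qed.

Lemma bet_block n i m : (i + m <= 2 ^ n)%N -> bet (block n i (i + m)) = bet (block n 0 m).
Proof.
elim: m => [|m IH] h; first by rewrite addn0 !blockE.
rewrite addnS (@block_cat n i (i + m))// ?leq_addr// (@block_cat n 0 m)//.
rewrite !block1; apply: bet_add_eq => //.
- by rewrite -block1; exact: block_disj.
- by rewrite -block1; exact: block_disj.
- by apply: IH; apply: leq_trans h; rewrite leq_add2l.
- by apply: bet_cell; [rewrite -addnS|apply: leq_trans h; exact: leq_addl].
Qed.

Lemma bet_block_lt n k m : (k < m)%N -> (m <= 2 ^ n)%N ->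
  bet (block n 0 k) < bet (block n 0 m).
Proof.
move=> km mn.
rewrite (@block_cat n 0 k m)// ?(ltnW km)//.
rewrite -[X in bet X < _]setU0 setUC [X in _ < bet X]setUC.
apply: bet_add_lt => //.
  by move=> w [? ?]; apply: (@block_disj n 0 k m w).
rewrite bet0; apply: (@lt_le_trans _ _ (bet (cell n k))).
  by apply: bet_cell_gt; exact: leq_trans mn.
apply: bet_le => //; by rewrite -block1 (@block_cat n k k.+1 m)//; left.
Qed.

Lemma bet_block_leE n k m : (k <= 2 ^ n)%N -> (m <= 2 ^ n)%N ->
  (bet (block n 0 k) <= bet (block n 0 m)) = (k <= m)%N.
Proof.
move=> kn mn; have [km|mk] := leqP k m; last first.
  by apply/negbTE; rewrite -ltNge bet_block_lt.
by apply: bet_le => //; rewrite (@block_cat n 0 k m)//; left.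
Qed.

Lemma bet_bracket n x : a <= x -> x <= b ->
  exists2 k, (k < 2 ^ n)%N & bet (block n 0 k) <= x <= bet (block n 0 k.+1).
Proof.
move=> ax xb.
have key m : x <= bet (block n 0 m.+1) ->
    exists2 k, (k < m.+1)%N & bet (block n 0 k) <= x <= bet (block n 0 k.+1).
  elim: m => [|m IH] h; first by exists 0%N => //; rewrite blockE bet0 ax.
  have [h'|h'] := leP x (bet (block n 0 m.+1)).
    by have [k km hk] := IH h'; exists k => //; exact: ltnW.
  by exists m.+1 => //; rewrite h (ltW h').
have n0 : (0 < 2 ^ n)%N by rewrite expn_gt0.
have := key (2 ^ n).-1; rewrite prednK// block_full betT; exact.
Qed.

(** The cells of index [1] at successive levels are pairwise disjoint, so each point lies in at most
    one and they converge to [set0]. Continuity makes their rank tend to [a], and the cell of index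
    [0] ties with them. *)
Lemma bet_cell_vanish c : a < c -> exists n, bet (cell n 0) < c.
Proof.
move=> ac.
have sub m n : (m <= n)%N -> cell n 0 `<=` cell m 0.
  move=> /subnK <-; elim: (n - m)%N => // k IH.
  exact: subset_trans (@cell_sub _ 0%N) IH.
have disj m n w : cell m.+1 1 w -> cell n.+1 1 w -> m = n.
  wlog: m n / (m < n)%N => [hw wm wn|mn wm wn].
    have [mn|nm|//] := ltngtP m n; first exact: hw.
    by apply/esym; exact: hw.
  exfalso; apply: (@cell_disj m.+1 1 0 _ w) => //; split => //.
  by apply: (sub m.+1 n) => //; exact: (@cell_sub n 1%N).
have : bet (cell n.+1 1) @[n --> \oo] --> bet set0.
  apply: bet_cont => //; apply: aeW => w.
  have [[m wm]|nw] := pselect (exists m, cell m.+1 1 w).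
    near=> n; split => // wn; have : (m < n)%N by near: n; exact: nbhs_infty_gt.
    by rewrite (disj _ _ _ wm wn) ltnn.
  by near=> n; split => // wn; apply: nw; exists n.
rewrite bet0 => lim; near \oo => n; exists n.+1.
rewrite (@bet_cell n.+1 0 1) ?expn_gt0//; last by rewrite (@ltn_exp2l 2 0).
by near: n; exact: (cvgr_lt _ lim).
Unshelve. all: by end_near. Qed.

End bets.

(** * Additive scales *)

Section scale.
Context {d : measure_display} {T : measurableType d} {R : realType}.
Variable P : probability T R.
Hypothesis naP : nonatomic P.
Variable I : (T -> R) -> R.
Hypothesis prefI : preference P I.
Local Notation act := (@Linf_rep d T R (@Fsig d T)).

Definition ranged (a b : R) (X : T -> R) := act X /\ forall w, a <= X w <= b.

(** Additivity over [A] and its complement is stated as a vanishing mixed difference. In this form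
    it needs no base act and survives affine changes of [psi] and shrinking of [[a, b]]. *)
Definition order_additive a b (psi : R -> R) :=
  (forall x y, a <= x -> x < y -> y <= b -> psi x < psi y) /\
  (forall A X X' Y Y', measurable A ->
    ranged a b X -> ranged a b X' -> ranged a b Y -> ranged a b Y' ->
    psi (I (glue A X Y)) + psi (I (glue A X' Y')) =
    psi (I (glue A X Y')) + psi (I (glue A X' Y))).

Section interval.
Variables a b : R.
Hypothesis ab : a < b.
Local Notation bet := (bet I a b).
Local Notation block := (block I a b).
Local Notation cell := (cell I a b).

Let mblock n i k : measurable (block n i k).
Proof. exact: (block_measurable prefI ab naP). Qed.
Let mcell n k : measurable (cell n k).
Proof. exact: (cell_measurable prefI ab naP). Qed.
Local Hint Resolve mblock mcell : core.

Lemma bet_itv S : measurable S -> a <= bet S <= b.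
Proof.
move=> mS; rewrite -{1}(bet0 prefI a b) -{4}(betT prefI a b).
by apply/andP; split; apply: (bet_le prefI ab).
Qed.

Definition scale x : R :=
  sup [set r | exists n k, [/\ (k <= 2 ^ n)%N, bet (block n 0 k) <= x & r = k%:R / 2 ^+ n]].

Let pow_gt0 n : 0 < 2 ^+ n :> R. Proof. by rewrite exprn_gt0. Qed.
Local Hint Resolve pow_gt0 : core.

Let divS k n : k.+1%:R / 2 ^+ n = k%:R / 2 ^+ n + 1 / 2 ^+ n :> R.
Proof. by rewrite -natr1 mulrDl. Qed.

Lemma scale_ge n k x : (k <= 2 ^ n)%N -> bet (block n 0 k) <= x -> k%:R / 2 ^+ n <= scale x.
Proof.
move=> kn kx; apply: ub_le_sup; last by exists n, k.
exists 1 => _ [m [j [jm _ ->]]]; rewrite ler_pdivrMr// mul1r -natrX ler_nat.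
exact: jm.
Qed.

(** Levels [m] and [n] are both refined to [m + n], where blocks are ranked by their number of
    cells; [a <= x] provides a member of the set whose supremum is taken. *)
Lemma scale_le n k x : (k <= 2 ^ n)%N -> a <= x -> x <= bet (block n 0 k) ->
  scale x <= k%:R / 2 ^+ n.
Proof.
move=> kn ax xk; apply: ge_sup.
  by exists (0%:R / 2 ^+ 0), 0%N, 0%N; split => //; rewrite blockE (bet0 prefI).
move=> _ [m [j [jm jx ->]]].
have := le_trans jx xk.
rewrite -(block_scale prefI ab naP m n 0 j) -(block_scale prefI ab naP n m 0 k) !muln0.
rewrite (addnC m n) (bet_block_leE prefI ab naP).
- move=> h; rewrite ler_pdivrMr// mulrAC ler_pdivlMr// -!natrX -!natrM ler_nat.
  by rewrite mulnC (mulnC k).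
- by rewrite expnD leq_mul2l jm orbT.
- by rewrite expnD mulnC leq_mul2r kn orbT.
Qed.

Lemma scale_bracket n x : a <= x -> x <= b ->
  exists k, [/\ (k < 2 ^ n)%N, bet (block n 0 k) <= x, x <= bet (block n 0 k.+1),
    k%:R / 2 ^+ n <= scale x & scale x <= k.+1%:R / 2 ^+ n].
Proof.
move=> ax xb; have [k kn /andP[h1 h2]] := bet_bracket prefI ab naP n ax xb.
by exists k; split => //; [apply: scale_ge => //; exact: ltnW|exact: scale_le].
Qed.

Lemma scale_a : scale a = 0.
Proof.
apply/eqP; rewrite eq_le; apply/andP; split.
  by rewrite -(mul0r (2 ^+ 0)^-1); apply: (@scale_le 0 0); rewrite // blockE (bet0 prefI).
by rewrite -(mul0r (2 ^+ 0)^-1); apply: (@scale_ge 0 0); rewrite // blockE (bet0 prefI).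
Qed.

Lemma scale_b : scale b = 1.
Proof.
have bE : bet (block 0 0 1) = b by rewrite block1 /= (betT prefI).
apply/eqP; rewrite eq_le; apply/andP; split.
  have -> : 1 = 1%:R / 2 ^+ 0 :> R by rewrite expr0 divr1.
  by apply: scale_le; rewrite // ?bE// ltW.
have -> : 1 = 1%:R / 2 ^+ 0 :> R by rewrite expr0 divr1.
by apply: scale_ge; rewrite // bE.
Qed.

Lemma scale_nd x y : a <= x -> x <= y -> y <= b -> scale x <= scale y.
Proof.
move=> ax xy yb; apply: (@le_pow2_approx _ 1) => n.
have [k [kn h1 _ _ h4]] := scale_bracket n ax (le_trans xy yb).
apply: (le_trans h4); rewrite -natr1 mulrDl lerD2r.
by apply: scale_ge; [exact: ltnW|exact: le_trans xy].
Qed.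

(** If [S] and [S'] lie between [k], [k.+1] and [j], [j.+1] cells, additivity of [bet] puts their
    union between [k + j] and [k + j + 2] cells. This fixes the scale up to [2 / 2 ^+ n]. *)
Lemma scale_add S S' : measurable S -> measurable S' -> S `&` S' `<=` set0 ->
  scale (bet (S `|` S')) = scale (bet S) + scale (bet S').
Proof.
move=> mS mS' SS'.
have mU : measurable (S `|` S') by exact: measurableU.
have /andP[S1 S2] := bet_itv mS; have /andP[S'1 S'2] := bet_itv mS'.
have /andP[U1 U2] := bet_itv mU.
suff key n : scale (bet S) + scale (bet S') - 2 / 2 ^+ n <= scale (bet (S `|` S'))
    <= scale (bet S) + scale (bet S') + 2 / 2 ^+ n.
  apply/eqP; rewrite eq_le; apply/andP; split; apply: (@le_pow2_approx _ 2) => n.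
    by case/andP: (key n).
  by rewrite -lerBlDr; case/andP: (key n).
have [k [kn k1 k2 k3 k4]] := scale_bracket n S1 S2.
have [j [jn j1 j2 j3 j4]] := scale_bracket n S'1 S'2.
(* Otherwise the union would strictly outrank a block of [2 ^ n] cells, which is the whole space. *)
have kjn : (k + j <= 2 ^ n)%N.
  rewrite leqNgt; apply/negP => lt.
  pose j' := (2 ^ n - k)%N.
  have j'j : (j' < j)%N by rewrite /j' ltn_subLR// ltnW.
  have kj' : (k + j')%N = (2 ^ n)%N by rewrite /j' subnKC// ltnW.
  have : bet (block n 0 (k + j')) < bet (S `|` S').
    rewrite (block_cat _ _ _ _ (leq0n k) (leq_addr _ _)) setUC [S `|` _]setUC.
    apply: (bet_add_lt prefI) => //.
    - by rewrite setIC; exact: (block_disj prefI ab naP).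
    - by rewrite setIC.
    - rewrite (bet_block prefI ab naP) ?kj'//; apply: lt_le_trans j1.
      by apply: (bet_block_lt prefI ab naP) => //; exact: ltnW.
  by rewrite kj' (block_full prefI ab naP) (betT prefI) ltNge U2.
apply/andP; split.
  have : (k + j)%:R / 2 ^+ n <= scale (bet (S `|` S')).
    apply: scale_ge => //.
    rewrite (block_cat _ _ _ _ (leq0n k) (leq_addr _ _)).
    apply: (bet_add_le prefI) => //; last by rewrite (bet_block prefI ab naP).
    exact: (block_disj prefI ab naP).
  rewrite natrD mulrDl; move: k4 j4; rewrite !divS; lra.
(* When there are not that many cells, the upper bound exceeds [1 = scale b] and holds trivially. *)
have [h|h] := leqP (k.+1 + j.+1) (2 ^ n).
  have : scale (bet (S `|` S')) <= (k.+1 + j.+1)%:R / 2 ^+ n.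
    apply: scale_le => //.
    rewrite (block_cat _ _ _ _ (leq0n k.+1) (leq_addr _ _)).
    apply: (bet_add_le prefI) => //; last by rewrite (bet_block prefI ab naP).
    exact: (block_disj prefI ab naP).
  rewrite natrD mulrDl !divS; lra.
have : scale (bet (S `|` S')) <= 1 by rewrite -scale_b; exact: scale_nd.
have : 1 <= (k.+1 + j.+1)%:R / 2 ^+ n :> R.
  by rewrite ler_pdivlMr// mul1r -natrX ler_nat ltnW.
rewrite natrD mulrDl !divS; lra.
Qed.

(** [x] is realised as [bet S] and [y] as [bet] of [S] with a disjoint [H]. As [H] is not null, it
    outranks some dyadic cell and so has positive scale. *)
Lemma scale_lt x y : a <= x -> x < y -> y <= b -> scale x < scale y.
Proof.
move=> ax xy yb.
have xT : x <= bet setT by rewrite (betT prefI) (le_trans (ltW xy)).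
have [S [mS _ Sx]] := bet_ivt prefI naP measurableT ax xT.
have mC : measurable (~` S) by exact: measurableC.
have cg : set_continuous P (fun H => bet (S `|` H) - y).
  apply: set_continuousB; last exact: set_continuous_cst.
  by apply: set_continuousU => //; exact: (bet_cont prefI).
have [||H [mH HS Hy]] := set_ivt naP cg mC.
- by rewrite setU0 Sx subr_le0 ltW.
- by rewrite setUv subr_ge0 (betT prefI).
have yE : y = bet (S `|` H) by apply/eqP; rewrite eq_sym -subr_eq0 Hy.
have SH : S `&` H `<=` set0 by move=> w [Sw /HS].
rewrite yE scale_add// Sx ltrDl.
have aH : a < bet H.
  have /andP[h _] := bet_itv mH; rewrite lt_neqAle h andbT; apply/eqP => e.
  have H0 := bet_null prefI ab mH (esym e).
  have : bet (S `|` H) = bet S.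
    apply: (set_continuous_ae (bet_cont prefI (a := a) (b := b))) => //; first exact: measurableU.
    have [N [mN N0 HN]] := pr_negligible mH H0.
    exists N; split => // w /= nw; apply: HN; apply: contrapT => nH; apply: nw.
    by split => [[]//|]; left.
  by rewrite -yE Sx => /eqP; rewrite gt_eqF.
have [n nH] := bet_cell_vanish prefI ab naP aH.
apply: (@lt_le_trans _ _ (1%:R / 2 ^+ n)); first by rewrite divr_gt0.
apply: scale_ge; first by rewrite expn_gt0.
by rewrite block1 ltW.
Qed.

Lemma scale_cvg x : a < x -> x < b -> scale y @[y --> x] --> scale x.
Proof.
move=> ax xb; apply/cvgrPdist_le => e e0.
have [n ne] : exists n, 3 / 2 ^+ n <= e.
  near \oo => n; exists n; apply: ltW; near: n.
  exact: (cvgr_lt _ (cvg_div_pow2 3)).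
have [k [kn k1 k2 k3 k4]] := scale_bracket n (ltW ax) (ltW xb).
(* Going one cell beyond the cell of [x] makes [c < x] strict at a cost of at most three cells; at
   the end of the interval [a] takes over. The point [f] mirrors this on the right. *)
have [c [ac cx cS]] : exists c, [/\ a <= c, c < x & scale x - 3 / 2 ^+ n <= scale c].
  case: k kn k1 k2 k3 k4 => [|k] kn k1 k2 k3 k4.
    exists a; split => //; rewrite scale_a; move: k4; rewrite divS.
    have : 0 <= 2 / 2 ^+ n :> R by rewrite divr_ge0.
    lra.
  exists (bet (block n 0 k)); have /andP[h _] := bet_itv (mblock n 0 k); split => //.
    by apply: lt_le_trans k1; apply: (bet_block_lt prefI ab naP) => //; exact: ltnW.
  have : k%:R / 2 ^+ n <= scale (bet (block n 0 k)) by apply: scale_ge => //; exact/ltnW/ltnW.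
  move: k4; rewrite !divS.
  have : 0 <= 1 / 2 ^+ n :> R by rewrite divr_ge0.
  lra.
have [f [fb xf fS]] : exists f, [/\ f <= b, x < f & scale f <= scale x + 3 / 2 ^+ n].
  have p0 : 0 <= 1 / 2 ^+ n :> R by rewrite divr_ge0.
  have [h|h] := leqP k.+2 (2 ^ n).
    exists (bet (block n 0 k.+2)); have /andP[h1 h2] := bet_itv (mblock n 0 k.+2).
    split => //.
      by apply: le_lt_trans k2 _; apply: (bet_block_lt prefI ab naP).
    have : scale (bet (block n 0 k.+2)) <= k.+2%:R / 2 ^+ n by exact: scale_le.
    rewrite !divS; lra.
  exists b; split => //; rewrite scale_b.
  have : 1 <= k.+2%:R / 2 ^+ n :> R.
    by rewrite ler_pdivlMr// mul1r -natrX ler_nat ltnW.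
  rewrite !divS; lra.
have N1 : \forall y \near x, c < y := cvgr_gt x cvg_id c cx.
have N2 : \forall y \near x, y < f := cvgr_lt x cvg_id f xf.
near=> y.
have cy : c < y by near: y; exact: N1.
have yf : y < f by near: y; exact: N2.
have h1 : scale c <= scale y by apply: scale_nd; [|exact: ltW|exact: ltW (lt_le_trans yf fb)].
have h2 : scale y <= scale f.
  by apply: scale_nd => //; [apply: ltW; exact: le_lt_trans ac cy|exact: ltW].
rewrite ler_distlC; lra.
Unshelve. all: by end_near. Qed.

Lemma scale_order_additive : order_additive a b scale.
Proof.
split; first exact: scale_lt.
(* [X] on [A] and [Y] off [A] are exchanged for bets on disjoint events of equal rank, to which
   [scale_add] applies. *)
have base A X Y : measurable A -> ranged a b X -> ranged a b Y ->
    scale (I (glue A X Y)) = scale (I (glue A X (cst a))) + scale (I (glue (~` A) Y (cst a))).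
  move=> mA [aX Xab] [aY Yab].
  have sub B Z : measurable B -> ranged a b Z ->
      exists S, [/\ measurable S, S `<=` B & bet S = I (glue B Z (cst a))].
    move=> mB [aZ Zab].
    have /andP[h1 h2] := pref_between prefI mB aZ (act_cst a) (fun w _ => Zab w).
    by rewrite glue_id (pref_cst prefI) in h1; apply: (bet_ivt prefI naP).
  have mC : measurable (~` A) by exact: measurableC.
  have [S [mS SA SX]] := sub A X mA (conj aX Xab).
  have [S' [mS' SA' SY]] := sub (~` A) Y mC (conj aY Yab).
  rewrite -SX -SY -scale_add//; last by move=> w [/SA Aw /SA'].
  congr scale.
  have E1 : glue S (cst b) (cst a) = glue A (glue S (cst b) (cst a)) (cst a).
    apply/funext => w; have [Aw|nA] := pselect (A w); first by rewrite [RHS]glueT.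
    by rewrite [RHS]glueF// glueF// => /SA.
  have E2 : glue S' (cst b) (cst a) = glue (~` A) (glue S' (cst b) (cst a)) (cst a).
    apply/funext => w; rewrite glueC; have [Aw|nA] := pselect (A w); last by rewrite [RHS]glueF.
    by rewrite [RHS]glueT// glueF// => /SA'.
  have E3 : glue (S `|` S') (cst b) (cst a) =
      glue (~` A) (glue S' (cst b) (cst a)) (glue S (cst b) (cst a)).
    apply/funext => w; rewrite glueC; have [Aw|nA] := pselect (A w).
      rewrite [RHS]glueT//; have [Sw|nS] := pselect (S w).
        by rewrite !glueT//; left.
      by rewrite !glueF// => -[//|/SA'].
    rewrite [RHS]glueF//; have [Sw|nS] := pselect (S' w).
      by rewrite !glueT//; right.
    by rewrite !glueF// => -[/SA|].
  have aS : act (glue S (cst b) (cst a)) by exact: act_glue.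
  have aS' : act (glue S' (cst b) (cst a)) by exact: act_glue.
  have -> : I (glue A X Y) = I (glue A (glue S (cst b) (cst a)) Y).
    apply: (pref_sure_thing_eq prefI (Z := cst a)) => //.
    by rewrite -E1 -SX.
  rewrite -[glue A _ Y]glueC -[RHS]/(I (glue (S `|` S') (cst b) (cst a))) E3.
  apply: (pref_sure_thing_eq prefI (Z := cst a)) => //.
  by rewrite -E2 -SY.
move=> A X X' Y Y' mA rX rX' rY rY'; rewrite (base A X Y)// (base A X' Y')// (base A X Y')// (base A X' Y)//.
by rewrite addrACA [X in _ + X]addrC -addrACA.
Qed.

(** [psi] is additive on bets as well, so its increments over the equally ranked cells of level [n]
    coincide. This fixes it on all blocks, and monotonicity squeezes it in between. *)
Lemma scale_unique psi x : order_additive a b psi -> a <= x -> x <= b ->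
  psi x = psi a + (psi b - psi a) * scale x.
Proof.
move=> [psi_lt psi_add] ax xb.
have psi_nd y z : a <= y -> y <= z -> z <= b -> psi y <= psi z.
  by move=> ay; rewrite le_eqVlt => /predU1P[->//|yz] zb; apply: ltW; exact: psi_lt.
have rc c : a <= c <= b -> ranged a b (cst c) by move=> h; split.
have ra : ranged a b (cst a) by apply: rc; rewrite lexx ltW.
have rb : ranged a b (cst b) by apply: rc; rewrite lexx ltW.
have psi_bet S S' : measurable S -> measurable S' -> S `&` S' `<=` set0 ->
    psi (bet (S `|` S')) = psi (bet S) + psi (bet S') - psi a.
  move=> mS mS' SS'.
  have rS' : ranged a b (glue S' (cst b) (cst a)).
    split => [|w]; first exact: act_glue.
    by rewrite /glue; case: ifP => _ /=; rewrite lexx ltW.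
  have := psi_add S (cst b) (cst a) (glue S' (cst b) (cst a)) (cst a) mS rb ra rS' ra.
  rewrite (_ : glue S (cst b) (glue S' _ _) = glue (S `|` S') (cst b) (cst a)); last first.
    by apply/funext => w; rewrite /glue in_setU; case: (w \in S).
  rewrite (_ : glue S (cst a) (glue S' _ _) = glue S' (cst b) (cst a)); last first.
    apply/funext => w; have [Sw|nS] := pselect (S w); last by rewrite glueF.
    by rewrite glueT// glueF// => S'w; exact: (SS' w).
  rewrite glue_id (pref_cst prefI) -/(bet S) -/(bet S') -/(bet (S `|` S')); lra.
have psi_block n k : (k <= 2 ^ n)%N ->
    psi (bet (block n 0 k)) = psi a + k%:R * (psi (bet (cell n 0)) - psi a).
  elim: k => [|k IH] kn; first by rewrite blockE (bet0 prefI) mul0r addr0.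
  rewrite (block_cat _ _ _ _ (leq0n k) (leqnSn k)) psi_bet//; last first.
    exact: (block_disj prefI ab naP).
  rewrite IH ?(ltnW kn)// block1 (bet_cell prefI ab naP (j := k) (k := 0))// ?expn_gt0//.
  by rewrite -natr1; lra.
have psi_unit n : psi (bet (cell n 0)) - psi a = (psi b - psi a) / 2 ^+ n.
  have := psi_block n (2 ^ n)%N (leqnn _).
  rewrite (block_full prefI ab naP) (betT prefI) => ->.
  by rewrite [psi a + _]addrC addrK natrX mulrAC divff ?mul1r// gt_eqF.
have D0 : 0 <= psi b - psi a by rewrite subr_ge0; apply: psi_nd => //; exact: ltW.
suff key n : psi a + (psi b - psi a) * scale x - (psi b - psi a) / 2 ^+ n <= psi x
    <= psi a + (psi b - psi a) * scale x + (psi b - psi a) / 2 ^+ n.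
  apply/eqP; rewrite eq_le; apply/andP; split;
    apply: (@le_pow2_approx _ (psi b - psi a)) => n.
    by case/andP: (key n).
  by rewrite -lerBlDr; case/andP: (key n).
have [k [kn k1 k2 k3 k4]] := scale_bracket n ax xb.
have /andP[_ h2] := bet_itv (mblock n 0 k.+1).
have /andP[h1 _] := bet_itv (mblock n 0 k).
have l1 := psi_nd _ _ h1 k1 xb.
have l2 := psi_nd _ _ ax k2 h2.
move: l1 l2; rewrite !psi_block// ?(ltnW kn)// psi_unit.
have := ler_wpM2l D0 k3; have := ler_wpM2l D0 k4.
rewrite -(natr1 k).
move: (psi b - psi a) (scale x) (psi x) (psi a) ((2 ^+ n)^-1) (k%:R) => D s p q u r.
by move=> m1 m2 l1 l2; apply/andP; split; lra.
Qed.

End interval.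
End scale.

(** * One normalised scale on the whole line *)

Section global_scale.
Context {d : measure_display} {T : measurableType d} {R : realType}.
Variable P : probability T R.
Hypothesis naP : nonatomic P.
Variable I : (T -> R) -> R.
Hypothesis prefI : preference P I.
Local Notation act := (@Linf_rep d T R (@Fsig d T)).

Lemma order_additiveS a b a' b' psi : a <= a' -> b' <= b ->
  order_additive I a b psi -> order_additive I a' b' psi.
Proof.
move=> aa bb [h1 h2].
have r X : ranged a' b' X -> ranged a b X.
  move=> [aX Xr]; split => // w; have /andP[l1 l2] := Xr w.
  by rewrite (le_trans aa l1) (le_trans l2 bb).
split=> [x y ax xy yb|A X X' Y Y' mA rX rX' rY rY'].
  by apply: h1 => //; [exact: le_trans ax|exact: le_trans yb bb].
by apply: h2 => //; exact: r.
Qed.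

Local Notation B M := (M.+1%:R : R).
Local Notation s M := (scale I (- B M) (B M)).
(** Normalised to be [0] at [0] and [1] at [1]; with half-width [M.+1] both points belong to every
    interval. *)
Let theta (M : nat) x := (s M x - s M 0) / (s M 1 - s M 0).

Let B_gt0 M : 0 < B M. Proof. by rewrite ltr0n. Qed.
Let BB M : - B M < B M. Proof. by have := B_gt0 M; lra. Qed.
Let s_oa M : order_additive I (- B M) (B M) (s M).
Proof. exact: (scale_order_additive naP prefI). Qed.

Let B_ge1 M : 1 <= B M. Proof. by rewrite ler1n. Qed.

Let s01 M : 0 < s M 1 - s M 0.
Proof.
by rewrite subr_gt0; case: (s_oa M) => + _; apply => //.
Qed.

(** On the smaller interval [s M'] is order additive, hence affine in [s M]; the normalisation
    cancels both coefficients. *)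
Let theta_consistent M M' x : (M <= M')%N -> - B M <= x -> x <= B M -> theta M' x = theta M x.
Proof.
move=> MM' x1 x2.
have le : B M <= B M' by rewrite ler_nat.
have oa : order_additive I (- B M) (B M) (s M').
  by apply: order_additiveS (s_oa M'); rewrite ?lerN2.
have E := scale_unique naP prefI (BB M) oa.
have p := B_gt0 M; have q := B_ge1 M.
rewrite /theta; have := s01 M'; rewrite !(E x, E 0, E 1)//; try lra.
have := s01 M.
set c := s M' (B M) - _ => h1 h2.
have c0 : c != 0.
  by apply/eqP => c0; move: h2; rewrite c0 !mul0r subrr ltxx.
have key (p' y z : R) : p' + c * y - (p' + c * z) = c * (y - z) by ring.
by rewrite !key -mulf_div divff// mul1r.
Qed.

Definition utility_scale x := theta (Num.truncn `|x|) x.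

Lemma utility_scaleE M x : - B M <= x -> x <= B M -> utility_scale x = theta M x.
Proof.
move=> x1 x2; rewrite /utility_scale.
have /andP[m1 m2] := truncn_itv (normr_ge0 x).
set m := Num.truncn _ in m1 m2 *.
have [mM|Mm] := leqP m M.
  by apply/esym/theta_consistent => //; move: m2; rewrite ltr_norml; lra.
by apply: theta_consistent => //; exact: ltnW.
Qed.

Let bound_nat (x y : R) : exists M, [/\ - B M < x, x < B M, - B M < y & y < B M].
Proof.
exists (Num.truncn `|x| + Num.truncn `|y|)%N.
have /andP[_ m1] := truncn_itv (normr_ge0 x).
have /andP[_ m2] := truncn_itv (normr_ge0 y).
have /= : (Num.truncn `|x|).+1%:R <= (Num.truncn `|x| + Num.truncn `|y|).+1%:R :> R.
  by rewrite ler_nat ltnS leq_addr.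
have /= : (Num.truncn `|y|).+1%:R <= (Num.truncn `|x| + Num.truncn `|y|).+1%:R :> R.
  by rewrite ler_nat ltnS leq_addl.
by move: m1 m2; rewrite !ltr_norml => /andP[? ?] /andP[? ?] ? ?; split; lra.
Qed.

Lemma utility_scale0 : utility_scale 0 = 0.
Proof. by rewrite /utility_scale /theta subrr mul0r. Qed.

Lemma utility_scale_lt x y : x < y -> utility_scale x < utility_scale y.
Proof.
move=> xy; have [M [x1 x2 y1 y2]] := bound_nat x y.
rewrite !(utility_scaleE (M := M)) ?ltW// /theta ltr_pM2r ?invr_gt0//.
by rewrite ltrD2r; case: (s_oa M) => + _; apply => //; rewrite ltW.
Qed.

Lemma utility_scale_cvg (x : R) : utility_scale y @[y --> x] --> utility_scale x.
Proof.
have [M [x1 x2 _ _]] := bound_nat x x.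
rewrite (utility_scaleE (M := M)) ?ltW//.
apply: (@cvg_trans _ (theta M y @[y --> x])).
  apply: near_eq_cvg.
  have N1 : \forall y \near x, - B M < y := cvgr_gt x cvg_id _ x1.
  have N2 : \forall y \near x, y < B M := cvgr_lt x cvg_id _ x2.
  near=> y; have y1 : - B M <= y by apply: ltW; near: y; exact: N1.
  have y2 : y <= B M by apply: ltW; near: y; exact: N2.
  by rewrite /= (utility_scaleE y1 y2).
have c1 : s M y - s M 0 @[y --> x] --> s M x - s M 0.
  by apply: cvgB; [exact: (scale_cvg naP prefI)|exact: cvg_cst].
exact: cvgM c1 (cvg_cst _).
Unshelve. all: by end_near. Qed.

Lemma utility_scale_add A X X' Y Y' : measurable A -> act X -> act X' -> act Y -> act Y' ->
    utility_scale (I (glue A X Y)) + utility_scale (I (glue A X' Y')) =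
    utility_scale (I (glue A X Y')) + utility_scale (I (glue A X' Y)).
Proof.
move=> mA aX aX' aY aY'.
have [M1 p1 b1] := Linf_rep_pos aX; have [M2 p2 b2] := Linf_rep_pos aX'.
have [M3 p3 b3] := Linf_rep_pos aY; have [M4 p4 b4] := Linf_rep_pos aY'.
pose K := M1 + M2 + M3 + M4.
have [M [_ KM _ _]] := bound_nat K K.
have r Z N : act Z -> (forall w, `|Z w| <= N) -> N <= K -> ranged (- B M) (B M) Z.
  by move=> aZ ZN NK; split => // w; have := ZN w; rewrite ler_norml; lra.
have rX : ranged (- B M) (B M) X by apply: (r _ M1) => //; rewrite /K; lra.
have rX' : ranged (- B M) (B M) X' by apply: (r _ M2) => //; rewrite /K; lra.
have rY : ranged (- B M) (B M) Y by apply: (r _ M3) => //; rewrite /K; lra.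
have rY' : ranged (- B M) (B M) Y' by apply: (r _ M4) => //; rewrite /K; lra.
have rI Z : ranged (- B M) (B M) Z -> - B M <= I Z /\ I Z <= B M.
  move=> [aZ Zr].
  have := @pref_between _ _ _ P I prefI (- B M) (B M) setT Z (cst 0) measurableT aZ
    (act_cst _) (fun w _ => Zr w).
  have gT W W' : glue [set: T] W W' = W :> (T -> R) by apply/funext => w; rewrite glueT.
  by rewrite !gT !(pref_cst prefI) => /andP[].
have rg Z Z' : ranged (- B M) (B M) Z -> ranged (- B M) (B M) Z' ->
    ranged (- B M) (B M) (glue A Z Z').
  move=> [aZ Zr] [aZ' Zr']; split; first exact: act_glue.
  by move=> w; rewrite /glue; case: ifP.
have [? ?] := rI _ (rg _ _ rX rY); have [? ?] := rI _ (rg _ _ rX' rY').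
have [? ?] := rI _ (rg _ _ rX rY'); have [? ?] := rI _ (rg _ _ rX' rY).
rewrite !(utility_scaleE (M := M))//.
have [_ /(_ A X X' Y Y' mA rX rX' rY rY')] := s_oa M.
rewrite /theta -!mulrDl => h; congr (_ / _).
by move: h; lra.
Qed.

End global_scale.

(** * Additive functionals on acts *)

Section additive_utility.
Context {d : measure_display} {T : measurableType d} {R : realType}.
Variable P : probability T R.
Local Notation act := (@Linf_rep d T R (@Fsig d T)).

(** Shared by [phi \o I] and by the mean of a regular integrand, which [additive_utility_eq] will
    identify. *)
Record additive_utility (V : (T -> R) -> R) : Prop := AdditiveUtility {
  util_ae : forall f g, act f -> act g -> aeeq P f g -> V f = V g;
  util_cvg : dominated_continuous P V;
  util0 : V (cst 0) = 0;
  util_add : forall A f, measurable A -> act f ->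
    V f = V (glue A f (cst 0)) + V (glue (~` A) f (cst 0)) }.

Lemma exists_additive_utility (I : (T -> R) -> R) : nonatomic P -> preference P I ->
  exists phi : R -> R, {homo phi : x y / x < y} /\ additive_utility (phi \o I).
Proof.
move=> naP prefI; exists (utility_scale I); split.
  by move=> x y; exact: (utility_scale_lt naP prefI).
split.
- by move=> f g af ag fg /=; rewrite (pref_ae prefI af ag fg).
- move=> X f aX af bX Xf /=.
  apply: (cvg_comp (fun n => I (X n)) (utility_scale I) (pref_cvg prefI aX af bX Xf)).
  exact: (utility_scale_cvg naP prefI).
- by rewrite /= (pref_cst prefI) utility_scale0.
- move=> A f mA af /=.
  (* With [X = Y = f] and [X' = Y' = 0] the mixed difference becomes additivity, as [phi] vanishes
     at [I 0 = 0]. *)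
  have := @utility_scale_add _ _ _ P naP I prefI A f (cst 0) f (cst 0) mA af
    (act_cst _) af (act_cst _).
  by rewrite !glue_id (pref_cst prefI) utility_scale0 addr0 glueC.
Qed.

End additive_utility.

(** * Densities and regular integrands *)

Section density.
Context {d : measure_display} {T : measurableType d} {R : realType}.
Variable P : probability T R.
Variable G : set (set T).
Hypothesis sG : sub_sigma G.
Let TG := g_sigma_algebraType G.

(** The identity, as a measurable map into [T] with the sigma-algebra [G]; its distribution [PG] is
    the restriction of [P] to [G]. *)
Let coarsen (w : T) : TG := w.

Let coarsen_measurable : measurable_fun [set: T] coarsen.
Proof.
by move=> _ A mA; rewrite setTI; apply: (sigma_measurable sG); rewrite -(sigmaE sG).
Qed.

Let coarsen_mfun : {mfun T >-> TG} :=
  MeasurableFun.Pack (MeasurableFun.Class (isMeasurableFun.Build _ _ _ _ _ coarsen_measurable)).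

Let PG : probability TG R := distribution P coarsen_mfun.

(* Radon-Nikodym on the space [T] equipped with the sub-sigma-algebra [G]. *)
Lemma exists_density (nu : set T -> R) :
  nu set0 = 0 ->
  (forall F : nat -> set T, (forall i, G (F i)) -> trivIset setT F ->
     \sum_(0 <= i < n) nu (F i) @[n --> \oo] --> nu (\bigcup_i F i)) ->
  (forall A, G A -> P A = 0%E -> nu A = 0) ->
  exists h : T -> R, [/\ G_meas G h, P.-integrable setT (EFin \o h) &
    forall A, G A -> (\int[P]_(w in A) (h w)%:E = (nu A)%:E)%E].
Proof.
move=> nu0 nus nuac.
pose nuE (A : set TG) : \bar R := (nu A)%:E.
have h0 : nuE set0 = 0%E by rewrite /nuE nu0.
have hf A : measurable A -> nuE A \is a fin_num by [].
have hs : semi_sigma_additive nuE.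
  move=> F mF tF mUF; have := nus F; rewrite -(sigmaE sG) => /(_ mF tF) h.
  under eq_fun do rewrite sumEFin.
  apply/fine_cvgP; split; first by near=> n.
  exact: h.
pose c := isCharge.Build _ TG R nuE h0 hf hs.
pose nuC : {charge set TG -> \bar R} := HB.pack nuE c.
have ac : nuC `<< PG.
  apply/null_content_dominatesP => A mA A0.
  by rewrite /nuC /= /nuE nuac//; rewrite -(sigmaE sG).
pose g := Radon_Nikodym nuC PG.
have gfin w : g w \is a fin_num by exact: Radon_Nikodym_fin_num.
have gint : PG.-integrable setT g by exact: Radon_Nikodym_integrable.
have mg : measurable_fun setT g by exact: measurable_int gint.
pose h (w : TG) := fine (g w).
have gE : g = EFin \o h by apply/funext => w; rewrite /h /= fineK.
have mh : measurable_fun [set: TG] h by apply/measurable_EFinP; rewrite -gE.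
have mhG : G_meas G h by apply/(G_measE sG).
have ih : P.-integrable setT (EFin \o (h : T -> R)).
  apply/integrableP; split.
    by apply/measurable_EFinP; exact: (G_meas_measurable sG).
  have /integrableP[_] := gint; rewrite ge0_integral_pushforward//.
    by rewrite gE preimage_setT.
  by apply: measurableT_comp.
exists h; split => // A GA.
have mA : measurable (A : set TG) by rewrite (sigmaE sG).
have := Radon_Nikodym_integral ac mA; rewrite -/g => e.
rewrite [RHS](_ : _ = nuC A)// e gE integral_pushforward//.
  by apply/measurable_EFinP.
apply: integrableS ih => //; exact: (sigma_measurable sG).
Unshelve. all: by end_near. Qed.

End density.

(** * Regular integrands and their means *)

Section regular.
Context {d : measure_display} {T : measurableType d} {R : realType}.
Variable P : probability T R.
Implicit Types (G : set (set T)) (phi : T -> R -> R).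
Local Notation act := (@Linf_rep d T R (@Fsig d T)).

Lemma regularF G phi : sub_sigma G -> regular G phi -> regular Fsig phi.
Proof.
move=> sG [h1 h2 h3 h4]; split => // B mB; move: (h4 B mB).
apply: smallest_sub; first exact: smallest_sigma_algebra.
move=> _ [A [C [GA mC ->]]] M [_]; apply; exists A, C; split => //.
exact: sG.2.
Qed.

(** The sets whose preimage under [w |-> (w, g w)] lies in [G] form a sigma-algebra containing the
    rectangles. *)
Lemma regular_G_meas G phi g : sub_sigma G -> regular G phi -> G_meas G g ->
  G_meas G (fun w => phi w (g w)).
Proof.
move=> sG [_ _ _ h4] mg B mB.
pose C := [set S : set (T * R) | G ((fun w => (w, g w)) @^-1` S)].
suff h : prod_sigma G `<=` C by exact: (h _ (h4 B mB)).
apply: smallest_sub.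
  split.
  - by rewrite /C /= preimage_set0; exact: (sigma0 sG).
  - by move=> A CA; rewrite setTD; exact: (sigmaC sG CA).
  - by move=> F CF; rewrite /C /= preimage_bigcup; exact: (sigma_bigcup sG).
move=> _ [A [D [GA mD ->]]]; rewrite /C /=.
have -> : (fun w => (w, g w)) @^-1` (A `*` D) = A `&` g @^-1` D by [].
by apply: (sigmaI sG) => //; exact: mg.
Qed.

Lemma regular_le G phi w x y : regular G phi -> x <= y -> phi w x <= phi w y.
Proof.
by move=> [_ h _ _]; rewrite le_eqVlt => /predU1P[->//|xy]; apply: ltW; exact: h.
Qed.

Lemma regular_inj G phi w x y : regular G phi -> phi w x = phi w y -> x = y.
Proof.
move=> [_ h _ _] e; apply/eqP; rewrite eq_le !leNgt; apply/andP; split; apply/negP => xy.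
  by have := h w _ _ xy; rewrite e ltxx.
by have := h w _ _ xy; rewrite e ltxx.
Qed.

(** By monotonicity two values bound all those in between. This is the integrable majorant for
    dominated convergence. *)
Lemma regular_norm_le G phi w x M : regular G phi -> `|x| <= M ->
  `|phi w x| <= `|phi w (- M)| + `|phi w M|.
Proof.
move=> rp; rewrite ler_norml => /andP[x1 x2].
have l1 := regular_le w rp x1; have l2 := regular_le w rp x2.
have n1 := ler_norm (phi w M); have n2 := ler_norm (- phi w (- M)).
rewrite normrN in n2.
have p1 := normr_ge0 (phi w M); have p2 := normr_ge0 (phi w (- M)).
by rewrite ler_norml; apply/andP; split; lra.
Qed.

Lemma Phi_regular G phi w y : regular G phi -> Phi phi w (phi w y) = y.
Proof.
move=> rp; rewrite /Phi (_ : [set _ | _] = `]y, +oo[%classic); first exact: inf_itv.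
apply/seteqP; split => z /=; rewrite in_itv/= andbT.
  by rewrite ltNge => /negP h; rewrite ltNge; apply/negP => zy; apply: h; exact: (regular_le _ rp).
by case: rp => _ h _ _; exact: h.
Qed.

Lemma Rintegral_gt0 A (g : T -> R) : measurable A -> P.-integrable A (EFin \o g) ->
  (forall w, A w -> 0 < g w) -> 0 < pr P A -> 0 < \int[P]_(w in A) g w.
Proof.
move=> mA ig g0 A0; rewrite lt_neqAle; apply/andP; split; last first.
  by apply: Rintegral_ge0 => w Aw; exact: ltW (g0 _ Aw).
apply/eqP => e.
have mg : measurable_fun A (EFin \o g) by exact: measurable_int ig.
have : (\int[P]_(w in A) `|(EFin \o g) w| = 0)%E.
  rewrite (eq_integral (EFin \o g)); last first.
    by move=> w /set_mem Aw /=; rewrite gtr0_norm// g0.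
  by rewrite -[LHS]fineK ?integrable_fin_num// -[fine _]e.
move=> /(ae_eq_integral_abs P mA mg)[N [mN N0 AN]].
have AsubN : A `<=` N.
  move=> w Aw; apply: AN => /= /(_ Aw)[] g0'.
  by have := g0 _ Aw; rewrite g0' ltxx.
have : (P A <= P N)%E by rewrite le_measure ?inE.
by rewrite N0 prE// lee_fin leNgt A0.
Qed.

Section mean.
Variable phi : T -> R -> R.
Hypothesis rp : regular (@Fsig d T) phi.
Hypothesis ip : forall x, P.-integrable setT (fun w => (phi w x)%:E).

Definition mean (f : T -> R) : R := \int[P]_w phi w (f w).

Lemma mean_integrable f A : act f -> measurable A ->
  P.-integrable A (fun w => (phi w (f w))%:E).
Proof.
move=> af mA; have [M M0 fM] := Linf_rep_pos af.
apply: (integrableS measurableT) => //.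
have : P.-integrable setT ((fun w => `|(phi w (- M))%:E|%E) \+ (fun w => `|(phi w M)%:E|%E))%E.
  by apply: integrableD => //; exact: integrable_abse.
apply: le_integrable => //.
  apply/measurable_EFinP; apply: (G_meas_measurable sub_sigmaF).
  by apply: (regular_G_meas sub_sigmaF rp); case: af.
move=> w _ /=; rewrite lee_fin.
by rewrite [X in _ <= X]ger0_norm ?addr_ge0//; exact: (regular_norm_le _ rp).
Qed.

(** The normalisation [phi w 0 = 0] turns cutting the act off [A] into restricting the domain of
    integration. *)
Lemma mean_glue A f : measurable A ->
  mean (glue A f (cst 0)) = \int[P]_(w in A) phi w (f w).
Proof.
move=> mA; rewrite Rintegral_mkcond; apply: eq_Rintegral => w _.
rewrite /restrict /glue; case: ifP => // _ /=.
by case: rp.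
Qed.

Lemma mean_additive_utility : additive_utility P mean.
Proof.
split.
- move=> f g af ag fg; rewrite /mean /Rintegral; congr fine.
  apply: ae_eq_integral => //.
  + exact: measurable_int (mean_integrable af measurableT).
  + exact: measurable_int (mean_integrable ag measurableT).
  + by apply: filterS fg => w /= -> _.
- move=> X f aX af [M XM] Xf.
  have [N N0 fN] := Linf_rep_pos af.
  apply: fine_cvg; rewrite /mean /Rintegral fineK ?integrable_fin_num ?mean_integrable//.
  have [||||| _ _] := @dominated_convergence _ T R P setT measurableT
    (fun n w => (phi w (X n w))%:E) (fun w => (phi w (f w))%:E)
    ((fun w => `|(phi w (- M))%:E|%E) \+ (fun w => `|(phi w M)%:E|%E))%E.
  + by move=> n; exact: measurable_int (mean_integrable (aX n) measurableT).
  + exact: measurable_int (mean_integrable af measurableT).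
  + apply: filterS Xf => w Xw _; apply/fine_cvgP; split; first by near=> n.
    case: rp => cp _ _ _; exact: (cvg_comp _ _ Xw (cp w (f w))).
  + by apply: integrableD => //; exact: integrable_abse.
  + apply: aeW => w n _ /=; rewrite lee_fin; exact: (regular_norm_le _ rp).
  exact.
- rewrite /mean (_ : (fun w => _) = cst 0); first by rewrite Rintegral_cst// mul0r.
  by apply/funext => w /=; case: rp.
- move=> A f mA af; rewrite !mean_glue//; last exact: measurableC.
  rewrite -Rintegral_setU//.
  + by rewrite setUv.
  + exact: measurableC.
  + by rewrite setUv; exact: mean_integrable.
  + by apply/disj_setPS; rewrite setICr.
Unshelve. all: by end_near. Qed.

End mean.

Lemma additive_utility_eq (V W : (T -> R) -> R) G :
  additive_utility P V -> additive_utility P W -> sub_sigma G ->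
  (forall x A, G A -> V (glue A (cst x) (cst 0)) = W (glue A (cst x) (cst 0))) ->
  forall f, Linf_rep G f -> V f = W f.
Proof.
move=> uV uW sG VW.
have simple (s : seq R) f : Linf_rep G f -> (forall w, f w \in 0 :: s) -> V f = W f.
  elim: s f => [|x s IH] f Gf fs.
    have -> : f = cst 0 by apply/funext => w; have := fs w; rewrite inE => /eqP.
    by rewrite (util0 uV) (util0 uW).
  pose A := [set w | f w = x].
  have GA : G A by case: Gf => + _; move=> /(_ [set x]); apply; exact: measurable_set1.
  have mA := sigma_measurable sG GA.
  have af := Linf_repF sG Gf.
  rewrite (util_add uV mA af) (util_add uW mA af); congr (_ + _).
    have -> : glue A f (cst 0) = glue A (cst x) (cst 0) by apply: glue_eq => // w.
    exact: VW.
  apply: IH.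
    by apply: (Linf_rep_glue sG) => //; [exact: (sigmaC sG)|exact: (Linf_rep_cst sG)].
  move=> w; have [Aw|nA] := pselect (A w).
    by rewrite glueF ?mem_head//; apply.
  rewrite glueT//; have := fs w; rewrite !inE => /or3P[->//|/eqP //|->].
  by rewrite orbT.
move=> f Gf; have [M M0 fM] := Linf_rep_pos Gf.
have Mf w : - M <= f w by have := fM w; rewrite ler_norml => /andP[].
have af := Linf_repF sG Gf.
have Gn n : Linf_rep G (grid (- M) n \o f) by exact: Linf_rep_grid.
have bn : exists M', forall n w, `|(grid (- M) n \o f) w| <= M'.
  exists M => n w /=; have [h1 /andP[_ h2]] := grid_bounds n (Mf w).
  by rewrite ler_norml h1 (le_trans h2)// (le_trans (ler_norm _)).
have cn : {ae P, forall w, (grid (- M) n \o f) w @[n --> \oo] --> f w}.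
  by apply: aeW => w; exact: grid_cvg.
have lV := util_cvg uV (fun n => Linf_repF sG (Gn n)) af bn cn.
have lW := util_cvg uW (fun n => Linf_repF sG (Gn n)) af bn cn.
apply: (cvg_uniq_lim lV); rewrite (_ : (fun n => _) = (fun n => W (grid (- M) n \o f)))//.
apply/funext => n; have [s sP] := @grid_range R (- M) n M.
apply: (simple s) => // w; rewrite inE; apply/orP; right; apply: sP.
exact: le_trans (ler_norm _) (fM w).
Qed.

End regular.

(** * Almost sure comparison and joint measurability *)

Section almost_everywhere.
Context {d : measure_display} {T : measurableType d} {R : realType}.
Variable P : probability T R.

Lemma ae_forall_count (C : countType) (Q : C -> T -> Prop) :
  (forall c, {ae P, forall w, Q c w}) -> {ae P, forall w, forall c, Q c w}.
Proof.
move=> h; have : {ae P, forall w, forall n, if unpickle n is Some c then Q c w else True}.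
  apply: ae_foralln => n; case: (unpickle n) => [c|]; first exact: h.
  exact: aeW.
by apply: filterS => w hw c; have := hw (pickle c); rewrite pickleK.
Qed.

Variable G : set (set T).
Hypothesis sG : sub_sigma G.

Lemma ae_lt_integral (h k : T -> R) : G_meas G h -> G_meas G k ->
  P.-integrable setT (EFin \o h) -> P.-integrable setT (EFin \o k) ->
  (forall A, G A -> 0 < pr P A -> \int[P]_(w in A) h w < \int[P]_(w in A) k w) ->
  {ae P, forall w, h w < k w}.
Proof.
move=> mh mk ih ik lt; pose A := [set w | k w <= h w].
have GA : G A by exact: G_meas_le.
have mA := sigma_measurable sG GA.
exists A; split => //; last by move=> w /= /negP; rewrite -leNgt.
apply: contrapT => /eqP A0.
have := lt _ GA (pr_neq0 mA A0); rewrite ltNge => /negP; apply.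
by apply: le_Rintegral => //; apply: (integrableS measurableT).
Qed.

(** Tested on the sets where one function exceeds the other, which belong to [G]. *)
Lemma ae_eq_condexp (h k : T -> R) : G_meas G h -> G_meas G k ->
  P.-integrable setT (EFin \o h) -> P.-integrable setT (EFin \o k) ->
  (forall A, G A -> \int[P]_(w in A) h w = \int[P]_(w in A) k w) -> aeeq P h k.
Proof.
have half (h' k' : T -> R) : G_meas G h' -> G_meas G k' ->
    P.-integrable setT (EFin \o h') -> P.-integrable setT (EFin \o k') ->
    (forall A, G A -> \int[P]_(w in A) h' w = \int[P]_(w in A) k' w) ->
    {ae P, forall w, h' w <= k' w}.
  move=> mh mk ih ik e; pose A := [set w | k' w < h' w].
  have GA : G A by exact: G_meas_lt.
  have mA := sigma_measurable sG GA.
  exists A; split => //; last by move=> w /= /negP; rewrite -ltNge.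
  apply: contrapT => /eqP A0.
  have ihA : P.-integrable A (EFin \o h') by exact: integrableS ih.
  have ikA : P.-integrable A (EFin \o k') by exact: integrableS ik.
  have : 0 < \int[P]_(w in A) (h' w - k' w).
    apply: Rintegral_gt0 => //; last exact: pr_neq0.
      have -> : EFin \o (fun w => h' w - k' w) = ((EFin \o h') \- (EFin \o k'))%E by [].
      exact: integrableB.
    by move=> w; rewrite subr_gt0.
  by rewrite RintegralB// e// subrr ltxx.
move=> mh mk ih ik e.
have h1 := half h k mh mk ih ik e.
have h2 := half k h mk mh ik ih (fun A GA => esym (e A GA)).
by apply: filterS2 h1 h2 => w l1 l2; apply/eqP; rewrite eq_le l1 l2.
Qed.

(** Continuity and monotonicity write [c < phi w x] as a countable union, over rational [q], of the
    rectangles given by [c < phi w (ratr q)] and [ratr q < x]. *)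
Lemma prod_sigma_measurable (phi : T -> R -> R) :
  (forall w, continuous (phi w)) -> (forall w x y, x < y -> phi w x < phi w y) ->
  (forall q : rat, G_meas G (fun w => phi w (ratr q))) ->
  forall B : set R, measurable B -> prod_sigma G ((fun p : T * R => phi p.1 p.2) @^-1` B).
Proof.
move=> cphi iphi mphi B.
pose C := [set B : set R | prod_sigma G ((fun p : T * R => phi p.1 p.2) @^-1` B)].
have sP : sigma_algebra setT (@prod_sigma d T R G) by exact: smallest_sigma_algebra.
change (measurable B) with ((@ocitv R).-sigma.-measurable B).
rewrite RGenOInfty.measurableE.
suff : <<s @RGenOInfty.G R>> `<=` C by apply.
apply: smallest_sub.
  case: sP => s0 sC sU; split.
  - by rewrite /C /= preimage_set0.
  - by move=> A CA; rewrite setTD /C /= preimage_setC -setTD; exact: sC.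
  - by move=> F CF; rewrite /C /= preimage_bigcup; exact: sU.
move=> _ [c ->]; rewrite /C /=.
pose D (n : nat) : set (T * R) := if unpickle n is Some q then
  [set w | c < phi w (ratr q)] `*` [set x | ratr q < x] else set0.
rewrite (_ : _ @^-1` _ = \bigcup_n D n).
  case: (sP) => s0 _ sU; apply: sU => n; rewrite /D; case: (unpickle n) => [q|] //.
  move=> M [_]; apply; exists [set w | c < phi w (ratr q)], [set x | ratr q < x].
  split => //; first by apply: (G_meas_lt sG) => //; exact: (G_meas_cst sG).
  rewrite (_ : [set x | _] = `]ratr q, +oo[%classic)//.
  by apply/seteqP; split => x /=; rewrite in_itv/= andbT.
apply/seteqP; split => [[w x]|[w x]] /=; rewrite in_itv/= andbT.
  move=> cx.
  have N : \forall y \near x, c < phi w y by exact: (cvgr_gt _ (cphi w x) _ cx).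
  have [y yx cy] : exists2 y, y < x & c < phi w y.
    have /nbhs_ballP[e /= e0 he] := N.
    exists (x - e / 2); first by rewrite ltrBlDr ltrDl divr_gt0.
    apply: he; rewrite /ball /= opprB addrC subrK gtr0_norm ?divr_gt0//.
    by rewrite ltr_pdivrMr// ltr_pMr// ltr1n.
  have [q] := rat_in_itvoo yx; rewrite in_itv/= => /andP[yq qx].
  exists (pickle q); first exact: I.
  rewrite /D pickleK; split => //=.
  exact: lt_trans cy (iphi w _ _ yq).
move=> [n _]; rewrite /D; case: (unpickle n) => [q|] //= [/= cq qx].
exact: lt_trans cq (iphi w _ _ qx).
Qed.

End almost_everywhere.

(** * Set functions induced by an additive functional *)

Section set_function.
Context {d : measure_display} {T : measurableType d} {R : realType}.
Variable P : probability T R.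
Variable V : (T -> R) -> R.
Hypothesis uV : additive_utility P V.
Local Notation act := (@Linf_rep d T R (@Fsig d T)).

Lemma util_split A B f : measurable A -> measurable B -> act f ->
  V (glue B f (cst 0)) = V (glue (B `&` A) f (cst 0)) + V (glue (B `\` A) f (cst 0)).
Proof.
move=> mA mB af; rewrite (util_add uV mA (act_glue mB af (act_cst 0))).
congr (V _ + V _); apply/funext => w; rewrite /glue ?in_setI ?in_setD ?in_setC.
  by case: (w \in A); case: (w \in B).
by case: (w \in A); case: (w \in B).
Qed.

Variable G : set (set T).
Hypothesis sG : sub_sigma G.

(** Continuity upgrades finite additivity of [A |-> V (x 1_A)] to countable additivity and makes it
    vanish on null sets, so Radon-Nikodym applies. *)
Lemma util_density x : exists h : T -> R,
  [/\ G_meas G h, P.-integrable setT (EFin \o h) &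
   forall A, G A -> \int[P]_(w in A) h w = V (glue A (cst x) (cst 0))].
Proof.
pose nu A := V (glue A (cst x) (cst 0)).
have nu0 : nu set0 = 0.
  by rewrite /nu (_ : glue _ _ _ = cst 0) ?(util0 uV)//; apply/funext => w; rewrite glueF.
have nu_cont : set_continuous P nu by apply: glue_set_continuous => //; exact: (util_cvg uV).
have [F mF tF| |h [mh ih hE]] := @exists_density _ _ _ P G sG nu nu0.
- pose U n := \bigcup_(i in `I_n) F i.
  have mU n : measurable (U n).
    by apply: bigcup_measurable => i _; exact: (sigma_measurable sG).
  have -> : (fun n => \sum_(0 <= i < n) nu (F i)) = nu \o U.
    apply/funext => n /=; elim: n => [|n IH].
      by rewrite big_geq// /U II0 bigcup_set0 nu0.
    rewrite big_nat_recr//= IH /nu.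
    rewrite (@util_split (F n) (U n.+1)) //; last exact: (sigma_measurable sG).
    rewrite addrC; congr (V (glue _ _ _) + V (glue _ _ _)).
    + apply/seteqP; split => [w Fw|w []//]; split => //.
      by exists n => //=.
    + apply/seteqP; split => w.
        move=> [i /= iltn Fiw]; split; first by exists i => //=; exact: ltnW.
        move=> Fnw; move: tF => /trivIsetP/(_ i n I I); rewrite neq_ltn iltn => /(_ isT).
        by move=> /seteqP[+ _] => /(_ w); apply.
      move=> [[i /= iltn Fiw] nFn]; exists i => //=.
      by move: iltn; rewrite ltnS leq_eqVlt => /predU1P[e|//]; rewrite e in Fiw.
  have -> : \bigcup_i F i = \bigcup_n U n.
    apply/seteqP; split => w [i _].
      by move=> Fw; exists i.+1 => //; exists i => //=.
    by move=> [j _ Fw]; exists j.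
  apply: (set_continuous_bigcup nu_cont) => //.
  apply/nondecreasing_seqP => n; apply/subsetPset => w [i /= iltn Fw].
  by exists i => //=; exact: ltnW.
- move=> A GA A0; have mA := sigma_measurable sG GA.
  rewrite -nu0; apply: (set_continuous_ae nu_cont) => //.
  by exists A; split => // w /= h; apply: contrapT => nA; apply: h; split.
- exists h; split => // A GA.
  by rewrite /Rintegral hE.
Qed.

End set_function.

(** * Regular versions of the densities *)

Section regular_version.
Context {d : measure_display} {T : measurableType d} {R : realType}.
Variable P : probability T R.
Variable V : (T -> R) -> R.
Hypothesis uV : additive_utility P V.
Hypothesis V_lt : forall x y A, x < y -> measurable A -> 0 < pr P A ->
  V (glue A (cst x) (cst 0)) < V (glue A (cst y) (cst 0)).
Variable G : set (set T).
Hypothesis sG : sub_sigma G.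
Local Notation act := (@Linf_rep d T R (@Fsig d T)).

Variable r : R -> T -> R.
Hypothesis rP : forall x, [/\ G_meas G (r x), P.-integrable setT (EFin \o r x) &
   forall A, G A -> \int[P]_(w in A) r x w = V (glue A (cst x) (cst 0))].

Let mr x : G_meas G (r x). Proof. by case: (rP x). Qed.
Let ir x : P.-integrable setT (EFin \o r x). Proof. by case: (rP x). Qed.
Let rE x A : G A -> \int[P]_(w in A) r x w = V (glue A (cst x) (cst 0)).
Proof. by case: (rP x) => _ _; exact. Qed.

Lemma density_lt_ae : {ae P, forall w, forall q : rat * rat, q.1 < q.2 ->
  r (ratr q.1) w < r (ratr q.2) w}.
Proof.
apply: ae_forall_count => -[p q] /=.
have [pq|qp] := boolP (p < q); last by apply: aeW.
have h : {ae P, forall w, r (ratr p) w < r (ratr q) w}.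
  apply: (ae_lt_integral sG) => // A GA A0; rewrite !rE//.
  by apply: V_lt => //; [rewrite ltr_rat|exact: (sigma_measurable sG)].
by apply: filterS h.
Qed.

Lemma density0_ae : {ae P, forall w, r 0 w = 0}.
Proof.
have h : aeeq P (r 0) (cst 0).
  apply: (ae_eq_condexp sG) => //.
  - exact: (G_meas_cst sG).
  - exact: integrable0.
  - move=> A GA; rewrite rE// glue_id (util0 uV) Rintegral_cst ?mul0r//.
    exact: (sigma_measurable sG).
exact: h.
Qed.

Definition dyad (M n i : nat) : R := i%:R / 2 ^+ n - M%:R.

(** Grid points are rational, hence within reach of [densities_increasing]. *)
Lemma dyad_ratr M n i : dyad M n i = ratr (i%:R / 2 ^+ n - M%:R).
Proof. by rewrite /dyad rmorphB /= fmorph_div rmorphXn /= !ratr_nat. Qed.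

(** With [dyad_half_ge]: the two-step window at index [j] of level [n.+1] lies inside the one at
    index [j./2] of level [n]. *)
Lemma dyad_half_le M n j : dyad M n j./2 <= dyad M n.+1 j.
Proof.
rewrite /dyad lerD2r exprS invfM mulrA ler_pM2r ?invr_gt0 ?exprn_gt0//.
rewrite ler_pdivlMr// -natrM ler_nat muln2 -{2}(odd_double_half j).
exact: leq_addl.
Qed.

Lemma dyad_half_ge M n j : dyad M n.+1 (j + 2) <= dyad M n (j./2 + 2).
Proof.
rewrite /dyad lerD2r exprS invfM mulrA ler_pM2r ?invr_gt0 ?exprn_gt0//.
rewrite ler_pdivrMr// -natrM ler_nat muln2 doubleD -{1}(odd_double_half j) -addnA.
by rewrite addnC -addnA leq_add2l; case: (odd j).
Qed.

Definition densities_increasing w :=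
  forall q : rat * rat, q.1 < q.2 -> r (ratr q.1) w < r (ratr q.2) w.

Lemma dens_dyad_le M n i N m j w : densities_increasing w ->
  dyad M n i <= dyad N m j -> r (dyad M n i) w <= r (dyad N m j) w.
Proof.
move=> inc; rewrite le_eqVlt => /predU1P[->//|].
rewrite !dyad_ratr ltr_rat => lt; apply: ltW.
exact: (inc (_, _) lt).
Qed.

(** On each level set of [k] both acts are constant and [V] integrates a density, so a density gap
    of [e] costs [e] times the probability; additivity sums over the level sets. *)
Lemma util_jump (e : R) (x y : nat -> R) (k : T -> nat) K B :
  (forall i, G [set w | k w = i]) -> G B -> act (x \o k) -> act (y \o k) ->
  (forall w, B w -> (k w < K)%N /\ e <= r (y (k w)) w - r (x (k w)) w) ->
  V (glue B (x \o k) (cst 0)) + e * pr P B <= V (glue B (y \o k) (cst 0)).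
Proof.
move=> Gk GB ax ay; elim: K B GB => [|K IH] B GB Bk.
  have -> : B = set0 by apply/seteqP; split => // w /Bk[].
  have g0 f : glue set0 f (cst 0) = cst 0 :> (T -> R) by apply/funext => w; rewrite glueF.
  by rewrite !g0 /pr measure0 mulr0 addr0.
pose A := [set w | k w = K].
have GA : G A by exact: Gk.
have mA := sigma_measurable sG GA; have mB := sigma_measurable sG GB.
have GI : G (B `&` A) by exact: (sigmaI sG).
have GD : G (B `\` A) by exact: (sigmaD sG).
have mI := sigma_measurable sG GI; have mD := sigma_measurable sG GD.
rewrite (util_split uV mA mB ax) (util_split uV mA mB ay).
have prB : pr P B = pr P (B `&` A) + pr P (B `\` A).
  rewrite -prU//; last by apply/disj_setPS => w [[_ Aw] [_ nA]].
  congr (pr P _); apply/seteqP; split => w /=; last by move=> [[]|[]].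
  by move=> Bw; have [?|?] := pselect (A w); [left|right].
have h1 : V (glue (B `\` A) (x \o k) (cst 0)) + e * pr P (B `\` A) <=
    V (glue (B `\` A) (y \o k) (cst 0)).
  apply: IH => // w [Bw nA]; have [h1 h2] := Bk _ Bw; split => //.
  by move: h1; rewrite ltnS leq_eqVlt => /predU1P[/nA|].
have gE (z : nat -> R) : glue (B `&` A) (z \o k) (cst 0) = glue (B `&` A) (cst (z K)) (cst 0).
  by apply: glue_eq => // w [_ /= ->].
have h2 : V (glue (B `&` A) (x \o k) (cst 0)) + e * pr P (B `&` A) <=
    V (glue (B `&` A) (y \o k) (cst 0)).
  rewrite !gE -!rE// -lerBrDl -RintegralB//; [|exact: integrableS (ir _)|exact: integrableS (ir _)].
  rewrite /pr -Rintegral_cst//; apply: le_Rintegral => //.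
  - exact: finite_measure_integrable_cst.
  - have -> : EFin \o (fun w => r (y K) w - r (x K) w) =
      ((EFin \o r (y K)) \- (EFin \o r (x K)))%E by [].
    by apply: integrableB => //; exact: integrableS (ir _).
  - by move=> w [Bw /= kw]; have [_] := Bk _ Bw; rewrite kw.
by rewrite prB mulrDr; lra.
Qed.

(** Windows span two grid steps and overlap, so that every point of []-M, M[], grid points included,
    is interior to one of them. *)
Definition oscillating (M : nat) (e : R) : set T :=
  [set w | forall n, exists2 i, (i < (2 * M) * 2 ^ n)%N &
    e <= r (dyad M n (i + 2)) w - r (dyad M n i) w].

Lemma G_oscillating M e : G (oscillating M e).
Proof.
rewrite (_ : oscillating M e = \bigcap_n \bigcup_i
  (if (i < (2 * M) * 2 ^ n)%N then
    [set w | e + r (dyad M n i) w <= r (dyad M n (i + 2)) w] else set0)).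
  apply: (sigma_bigcap sG) => n; apply: (sigma_bigcup sG) => i; case: ifP => _; last exact: (sigma0 sG).
  apply: (G_meas_le sG) => //; apply/(G_measE sG); apply: measurable_funD => //.
  exact/(G_measE sG).
apply/seteqP; split => w h n.
  move=> _; have [i il ei] := h n; exists i => //; rewrite il /=; lra.
have [i _] := h n I; case: ifP => // il /= ei; exists i => //; lra.
Qed.

(* Were the densities to oscillate by [e] on arbitrarily fine grids over a set [B] of positive
   measure, the leftmost cells [Y n, Y n + 2 / 2 ^ n] where this happens would
   converge monotonically, and [V] would jump at the limit. *)
Lemma oscillating_null M e B : 0 < e -> G B -> B `<=` oscillating M e ->
  (forall w, B w -> densities_increasing w) -> pr P B = 0.
Proof.
move=> e0 GB Bosc Binc.
have mB := sigma_measurable sG GB.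
pose K n := ((2 * M) * 2 ^ n)%N.
pose a n w i := e <= r (dyad M n (i + 2)) w - r (dyad M n i) w.
(* Index of the leftmost oscillating window; where there is none, which can happen off [B], [find]
   returns [K n]. *)
pose k n w := find (a n w) (iota 0 (K n)).
have kP n w : B w -> (k n w < K n)%N /\ a n w (k n w).
  move=> Bw; have [i il ei] := Bosc _ Bw n.
  have ha : has (a n w) (iota 0 (K n)) by apply/hasP; exists i => //; rewrite mem_iota.
  have := ha; rewrite has_find size_iota => lt; split => //.
  by have := nth_find 0%N ha; rewrite nth_iota.
have kmin n w i : (i < K n)%N -> a n w i -> (k n w <= i)%N.
  move=> iK ai; rewrite leqNgt; apply/negP => lt.
  by have := before_find 0%N lt; rewrite nth_iota// ai.
have kle n w : (k n w <= K n)%N by rewrite /k -[X in (_ <= X)%N](size_iota 0) find_size.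
have Ga n i : G [set w | a n w i].
  rewrite (_ : [set w | _] = [set w | e + r (dyad M n i) w <= r (dyad M n (i + 2)) w]).
    apply: (G_meas_le sG) => //; apply/(G_measE sG); apply: measurable_funD => //.
    exact/(G_measE sG).
  by apply/seteqP; split => w; rewrite /a /=; lra.
have Gkge n i : (i <= K n)%N -> G [set w | (i <= k n w)%N].
  elim: i => [|i IH] iK.
    by rewrite (_ : [set w | _] = setT); [exact: (sigmaT sG)|apply/seteqP; split].
  rewrite (_ : [set w | _] = [set w | (i <= k n w)%N] `\` [set w | a n w i]).
    by apply: (sigmaD sG) => //; apply: IH; exact: ltnW.
  apply/seteqP; split => w /=.
    move=> lt; split; first exact: ltnW.
    by move=> /(kmin n w i iK); rewrite leqNgt lt.
  move=> [ik nai]; rewrite ltn_neqAle ik andbT; apply/eqP => ik'.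
  apply: nai; rewrite ik'; have lt : (k n w < K n)%N by rewrite -ik'.
  have ha : has (a n w) (iota 0 (K n)) by rewrite has_find size_iota.
  by have := nth_find 0%N ha; rewrite nth_iota.
have Gk n i : G [set w | k n w = i].
  have [iK|Ki] := ltnP i (K n).
    rewrite (_ : [set w | _] = [set w | (i <= k n w)%N] `\` [set w | (i.+1 <= k n w)%N]).
      by apply: (sigmaD sG); apply: Gkge => //; exact: ltnW.
    apply/seteqP; split => w /=; first by move=> ->; rewrite ltnn leqnn; split.
    by move=> [h1 h2]; apply/eqP; rewrite eqn_leq h1 andbT leqNgt; apply/negP.
  have [iK|iK] := eqVneq i (K n).
    rewrite (_ : [set w | _] = [set w | (i <= k n w)%N]); first by apply: Gkge; rewrite iK.
    apply/seteqP; split => w /=; first by move=> ->.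
    by move=> h; apply/eqP; rewrite eqn_leq h iK kle.
  rewrite (_ : [set w | _] = set0); first exact: (sigma0 sG).
  apply/seteqP; split => w //= kwi; have := kle n w; rewrite kwi leqNgt ltn_neqAle Ki.
  by rewrite eq_sym iK.
have Gmk n (z : nat -> R) : G_meas G (z \o k n).
  move=> D mD; rewrite (_ : _ @^-1` _ = \bigcup_i
    (if `[< D (z i) >] then [set w | k n w = i] else set0)).
    by apply: (sigma_bigcup sG) => i; case: ifP => // _; exact: (sigma0 sG).
  apply/seteqP; split => w /=.
    by move=> Dz; exists (k n w) => //; rewrite asboolT.
  by move=> [i _]; case: ifPn => // /asboolP Di /= ->.
have bnd n i : (i <= K n + 2)%N -> `|dyad M n i| <= M%:R + 2.
  move=> iK; rewrite /dyad ler_norml; apply/andP; split.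
    have : 0 <= i%:R / 2 ^+ n :> R by rewrite divr_ge0// exprn_ge0.
    lra.
  have : i%:R / 2 ^+ n <= 2 * M%:R + 2 :> R.
    rewrite ler_pdivrMr ?exprn_gt0//.
    apply: (@le_trans _ _ (K n + 2)%:R); first by rewrite ler_nat.
    have p1 : 1 <= 2 ^+ n :> R by rewrite exprn_ege1// ler1n.
    rewrite natrD /K !natrM natrX; move: p1; move: (2 ^+ n) (M%:R) => z y; lra.
  lra.
have aY n (c : nat) : (c <= 2)%N -> act ((fun i => dyad M n (i + c)) \o k n).
  move=> c2; split; first by move=> D mD; apply: sG.2; exact: Gmk.
  by exists (M%:R + 2) => w /=; apply: bnd; exact: leq_add.
pose Y n := glue B ((fun i => dyad M n (i + 0)) \o k n) (cst 0).
pose Z n := glue B ((fun i => dyad M n (i + 2)) \o k n) (cst 0).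
have YZ n : V (Y n) + e * pr P B <= V (Z n).
  apply: (@util_jump e _ _ _ (K n)) => //; [exact: aY|exact: aY|].
  by move=> w Bw; have [h1 h2] := kP n w Bw; split => //; rewrite addn0.
have Ynd w : nondecreasing_seq (Y ^~ w).
  apply/nondecreasing_seqP => n; rewrite /Y.
  have [Bw|nB] := pselect (B w); last by rewrite !glueF.
  rewrite !glueT//= !addn0.
  have [jK aj] := kP n.+1 w Bw; set j := k n.+1 w in jK aj *.
  have jK2 : (j./2 < K n)%N.
    by rewrite ltn_half_double; move: jK; rewrite /K expnS mulnCA mul2n.
  (* The coarser window contains the finer one and the densities increase, so it oscillates as much.
     Hence the leftmost window of level [n] starts no later. *)
  have aj2 : a n w j./2.
    apply: (le_trans aj).
    have l1 := dens_dyad_le (Binc _ Bw) (dyad_half_le M n j).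
    have l2 := dens_dyad_le (Binc _ Bw) (dyad_half_ge M n j).
    lra.
  have := kmin _ _ _ jK2 aj2 => kj.
  apply: le_trans (dyad_half_le M n j).
  by rewrite /dyad lerD2r ler_pM2r ?invr_gt0 ?exprn_gt0// ler_nat.
have YM n w : `|Y n w| <= M%:R + 2.
  rewrite /Y; have [Bw|nB] := pselect (B w); last first.
    by rewrite glueF//= normr0 addr_ge0.
  by rewrite glueT//=; apply: bnd; rewrite addn0; exact: leq_trans (kle n w) (leq_addr _ _).
have ZE n w : Z n w = Y n w + glue B (cst (2 / 2 ^+ n)) (cst 0) w.
  rewrite /Z /Y; have [Bw|nB] := pselect (B w); last by rewrite !glueF//= addr0.
  rewrite !glueT//= /dyad addn0 natrD mulrDl; lra.
pose f w := limn (Y ^~ w).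
have Yf w : Y n w @[n --> \oo] --> f w.
  apply: nondecreasing_is_cvgn => //; exists (M%:R + 2) => _ [n _ <-].
  exact: le_trans (ler_norm _) (YM n w).
have actY n : act (Y n) by apply: act_glue => //; exact: aY.
have actZ n : act (Z n) by apply: act_glue => //; exact: aY.
have af : act f.
  split.
    move=> D mD; have mf : measurable_fun setT f.
      apply: (@measurable_fun_cvg _ _ _ setT Y) => // n.
      by apply: (G_meas_measurable sub_sigmaF); case: (actY n).
    by have := mf measurableT D mD; rewrite setTI.
  exists (M%:R + 2) => w; rewrite ler_norml; apply/andP; split.
    by apply: (cvg_ge_bound (Yf w)) => n; have := YM n w; rewrite ler_norml => /andP[].
  by apply: (cvg_le_bound (Yf w)) => n; have := YM n w; rewrite ler_norml => /andP[].
have lY : V (Y n) @[n --> \oo] --> V f.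
  apply: (util_cvg uV) => //; first by exists (M%:R + 2).
  exact: aeW.
have lZ : V (Z n) @[n --> \oo] --> V f.
  apply: (util_cvg uV) => //.
    exists (M%:R + 2 + 2) => n w; rewrite ZE (le_trans (ler_normD _ _))//.
    apply: lerD; first exact: YM.
    rewrite /glue; case: ifP => _ /=; last by rewrite normr0.
    rewrite ger0_norm ?divr_ge0 ?exprn_ge0//.
    have p1 : 1 <= 2 ^+ n :> R by rewrite exprn_ege1// ler1n.
    rewrite ler_pdivrMr ?exprn_gt0//; move: p1; move: (2 ^+ n) => z; lra.
  apply: aeW => w.
  have gz : glue B (cst (2 / 2 ^+ n)) (cst 0) w @[n --> \oo] --> (0 : R).
    have [Bw|nB] := pselect (B w).
      rewrite (_ : (fun n => _) = (fun n => 2 / 2 ^+ n)); first exact: cvg_div_pow2.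
      by apply/funext => n; rewrite glueT.
    rewrite (_ : (fun n => _) = (fun=> 0)); first exact: cvg_cst.
    by apply/funext => n; rewrite glueF.
  rewrite (_ : (fun n => _) = (fun n => Y n w + glue B (cst (2 / 2 ^+ n)) (cst 0) w)).
    by rewrite -[f w]addr0; exact: cvgD (Yf w) gz.
  by apply/funext => n; exact: ZE.
have : V f + e * pr P B <= V f.
  apply: (cvg_le_cvg _ lZ YZ); apply: cvgD => //; exact: cvg_cst.
rewrite gerDl pmulr_rle0// => h.
by apply/eqP; rewrite eq_le h pr_ge0.
Qed.

Lemma G_increasing : G [set w | densities_increasing w].
Proof.
rewrite (_ : [set w | _] = \bigcap_n (if unpickle n is Some (p, q) then
    if (p : rat) < q then [set w | r (ratr p) w < r (ratr q) w] else setT else setT)).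
  apply: (sigma_bigcap sG) => n; case: (unpickle n) => [[p q]|]; last exact: (sigmaT sG).
  by case: ifP => _; [apply: (G_meas_lt sG)|exact: (sigmaT sG)].
apply/seteqP; split => w h.
  by move=> n _; case: (unpickle n) => [[p q]|//]; case: ifP => // pq; exact: (h (p, q)).
by move=> [p q] /= pq; have := h (pickle (p, q)) I; rewrite pickleK pq; exact.
Qed.

(** Thresholds [1 / m.+1] and natural [M] keep the conditions countable, hence [good] in [G] and of
    full measure. *)
Definition good : set T := [set w | [/\ densities_increasing w, r 0 w = 0 &
  forall Mm : nat * nat, ~ oscillating Mm.1 (Mm.2.+1%:R^-1) w]].

Lemma G_good : G good.
Proof.
pose Osc := \bigcap_n (if unpickle n is Some (M, m) then
  ~` oscillating M ((m : nat).+1%:R^-1) else setT).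
rewrite (_ : good = [set w | densities_increasing w] `&` [set w | r 0 w = 0] `&` Osc).
  apply: (sigmaI sG); [apply: (sigmaI sG)|].
  - exact: G_increasing.
  - by have := mr 0; move=> /(_ [set 0] (measurable_set1 0)).
  - apply: (sigma_bigcap sG) => n; case: (unpickle n) => [[M m]|]; last exact: (sigmaT sG).
    by apply: (sigmaC sG); exact: G_oscillating.
apply/seteqP; split => w.
  move=> [h1 h2 h3]; split; [by split|].
  by move=> n _; case: (unpickle n) => [[M m]|//]; exact: (h3 (M, m)).
move=> [[h1 h2] h3]; split => // -[M m] /=.
by have := h3 (pickle (M, m)) I; rewrite pickleK; exact.
Qed.

Lemma good_ae : {ae P, forall w, good w}.
Proof.
have h3 : {ae P, forall w, forall Mm : nat * nat,
    densities_increasing w -> ~ oscillating Mm.1 (Mm.2.+1%:R^-1) w}.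
  apply: ae_forall_count => -[M m] /=.
  pose B := oscillating M (m.+1%:R^-1) `&` [set w | densities_increasing w].
  have GB : G B by apply: (sigmaI sG); [exact: G_oscillating|exact: G_increasing].
  have B0 : pr P B = 0.
    by apply: (@oscillating_null M (m.+1%:R^-1)) => // w [].
  have [N [mN N0 BN]] := pr_negligible (sigma_measurable sG GB) B0.
  by exists N; split => // w /= nw; apply: BN; split; apply: contrapT => h; exact: nw.
apply: filterS3 density_lt_ae density0_ae h3 => w h1 h2 h3; split => // Mm; exact: h3.
Qed.

(** Left limit along the rationals; off [good] the identity in [x], which is itself continuous,
    increasing and zero at [0]. *)
Definition regularize (w : T) (x : R) : R :=
  if w \in good then sup [set r (ratr q) w | q in [set q : rat | ratr q < x]] else x.

Section good_point.
Variable w : T.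
Hypothesis gw : good w.
Let u := regularize w.

Let uE x : u x = sup [set r (ratr q) w | q in [set q : rat | ratr q < x]].
Proof. by rewrite /u /regularize mem_set. Qed.

Let r_le p q : (p <= q)%R -> r (ratr p) w <= r (ratr q) w.
Proof.
case: gw => inc _ _; rewrite le_eqVlt => /predU1P[->//|pq]; apply: ltW.
exact: (inc (p, q)).
Qed.

Let ge_dens q x : ratr q < x -> r (ratr q) w <= u x.
Proof.
move=> qx; rewrite uE; apply: ub_le_sup; last by exists q.
have [p] := @rat_in_itvoo R x (x + 1) (ltr_pwDr ltr01 (lexx x)).
rewrite in_itv/= => /andP[xp _]; exists (r (ratr p) w) => _ [q' /= q'x <-].
by apply: r_le; rewrite -(ler_rat R) ltW// (lt_trans q'x).
Qed.

Let le_dens q x : x <= ratr q -> u x <= r (ratr q) w.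
Proof.
move=> xq; rewrite uE; apply: ge_sup.
  have x1 : x - 1 < x by rewrite ltrBlDr ltr_pwDr.
  have [p] := @rat_in_itvoo R _ _ x1.
  by rewrite in_itv/= => /andP[_ px]; exists (r (ratr p) w), p.
move=> _ [p /= px <-]; apply: r_le; rewrite -(ler_rat R).
exact: le_trans (ltW px) xq.
Qed.

Lemma regularize_lt x y : x < y -> u x < u y.
Proof.
move=> xy; have [p] := rat_in_itvoo xy; rewrite in_itv/= => /andP[xp py].
have [q] := rat_in_itvoo py; rewrite in_itv/= => /andP[pq qy].
apply: (le_lt_trans (le_dens (ltW xp))); apply: lt_le_trans (ge_dens qy).
by case: gw => inc _ _; apply: (inc (p, q)); rewrite /= -(ltr_rat R).
Qed.

(** A good point has a level at which every window oscillates by less than [e]; a window around [x]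
    then bounds [u] at all its points. *)
Lemma regularize_continuous : continuous u.
Proof.
move=> x; apply/cvgrPdist_lt => e e0.
have [m me] : exists m : nat, m.+1%:R^-1 < e.
  near \oo => m; exists m; near: m; exact: (near_infty_natSinv_lt (PosNum e0)).
(* The margin [1] between [|x|] and [M] ensures [t > 0] below, so that the window can start at
   [t.-1], strictly left of [x]. *)
pose M := (Num.truncn `|x|).+2.
have xM : `|x| + 1 < M%:R.
  have /andP[_] := truncn_itv (normr_ge0 x); rewrite /M -[in X in _ -> X]natr1; lra.
have xM1 : - M%:R + 1 < x.
  by have := ler_norm (- x); rewrite normrN; lra.
have xM2 : x < M%:R by have := ler_norm x; lra.
have [_ _ /(_ (M, m)) /=] := gw.
rewrite /oscillating /= => /existsNP[n hn].
have small i : (i < 2 * M * 2 ^ n)%N -> r (dyad M n (i + 2)) w - r (dyad M n i) w < m.+1%:R^-1.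
  by move=> il; rewrite ltNge; apply/negP => h; apply: hn; exists i.
have p0 : 0 < 2 ^+ n :> R by rewrite exprn_gt0.
have p1 : 1 <= 2 ^+ n :> R by rewrite exprn_ege1// ler1n.
pose t := Num.truncn ((x + M%:R) * 2 ^+ n).
have /andP[t1 t2] : t%:R <= (x + M%:R) * 2 ^+ n < t.+1%:R.
  by apply: truncn_itv; rewrite mulr_ge0 ?ltW//; lra.
have t0 : (0 < t)%N.
  rewrite -ltnS -(ltr_nat R); apply: le_lt_trans t2.
  by apply: (le_trans p1); rewrite ler_peMl// ?ltW//; lra.
have tE : (t.-1 + 2)%N = t.+1 by rewrite addn2 prednK.
have il : (t.-1 < 2 * M * 2 ^ n)%N.
  rewrite prednK// -(ler_nat R); apply: (le_trans t1).
  rewrite !natrM natrX ler_pM2r//; lra.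
have lo : dyad M n t.-1 < x.
  rewrite /dyad ltrBlDr ltr_pdivrMr//; apply: lt_le_trans t1.
  by rewrite ltr_nat prednK.
have hi : x < dyad M n (t.-1 + 2) by rewrite tE /dyad ltrBrDr ltr_pdivlMr.
have N1 : \forall y \near x, dyad M n t.-1 < y := cvgr_gt x cvg_id _ lo.
have N2 : \forall y \near x, y < dyad M n (t.-1 + 2) := cvgr_lt x cvg_id _ hi.
have sm := small _ il.
near=> y.
have y1 : dyad M n t.-1 < y by near: y; exact: N1.
have y2 : y < dyad M n (t.-1 + 2) by near: y; exact: N2.
have bnd z : dyad M n t.-1 < z -> z < dyad M n (t.-1 + 2) ->
    r (dyad M n t.-1) w <= u z <= r (dyad M n (t.-1 + 2)) w.
  rewrite !dyad_ratr => z1 z2; apply/andP; split; first exact: ge_dens.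
  by apply: le_dens; exact: ltW.
have /andP[b1 b2] := bnd _ lo hi; have /andP[b3 b4] := bnd _ y1 y2.
move: sm me; move: (m.+1%:R^-1) => v sm me.
by rewrite ltr_norml; apply/andP; split; lra.
Unshelve. all: by end_near. Qed.

(** A left limit could fall short of the density; continuity from the right excludes it, since [u]
    is at least [r (ratr q) w] at every point beyond [ratr q]. *)
Lemma regularize_rat q : u (ratr q) = r (ratr q) w.
Proof.
apply/eqP; rewrite eq_le le_dens//=.
apply: (@cvg_ge_bound _ (fun n => u (ratr q + harmonic n))).
  have qn : ratr q + harmonic n @[n --> \oo] --> (ratr q : R).
    rewrite -[X in _ --> X]addr0; apply: cvgD; first exact: cvg_cst.
    exact: cvg_harmonic.
  exact: (cvg_comp _ _ qn (regularize_continuous (x := ratr q))).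
by move=> n; apply: ge_dens; rewrite ltrDl /harmonic /= invr_gt0 ltr0n.
Qed.

End good_point.

Lemma regular_regularize : regular G regularize.
Proof.
have mono w x y : x < y -> regularize w x < regularize w y.
  move=> xy; have [gw|ngw] := pselect (good w); first exact: regularize_lt.
  by rewrite /regularize memNset.
have cont w : continuous (regularize w).
  have [gw|ngw] := pselect (good w); first exact: regularize_continuous.
  rewrite (_ : regularize w = id); first by move=> x; exact: cvg_id.
  by apply/funext => x; rewrite /regularize memNset.
split => //.
  move=> w; have [gw|ngw] := pselect (good w); last by rewrite /regularize memNset.
  by have := regularize_rat gw 0; rewrite rmorph0 => ->; case: gw.
apply: (prod_sigma_measurable sG) => // q.
rewrite (_ : (fun w => _) = glue good (r (ratr q)) (cst (ratr q))).
  by apply: (G_meas_glue sG) => //; [exact: G_good|exact: (G_meas_cst sG)].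
apply/funext => w; have [gw|ngw] := pselect (good w).
  by rewrite glueT// regularize_rat.
by rewrite glueF// /regularize memNset.
Qed.

Let mu_reg x : measurable_fun setT (fun w => (regularize w x)%:E).
Proof.
apply/measurable_EFinP; apply: (G_meas_measurable sG).
exact: (regular_G_meas sG regular_regularize (G_meas_cst sG x)).
Qed.

Lemma regularize_rat_ae q : {ae P, forall w, regularize w (ratr q) = r (ratr q) w}.
Proof. by apply: filterS good_ae => w gw; exact: regularize_rat. Qed.

Let irat q : P.-integrable setT (fun w => (regularize w (ratr q))%:E).
Proof.
apply/integrableP; split => //.
have /integrableP[mrq] := ir (ratr q); apply: le_lt_trans.
rewrite le_eqVlt; apply/orP; left; apply/eqP.
apply: ae_eq_integral => //.
- exact: measurableT_comp.
- exact: measurableT_comp.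
- by apply: filterS (regularize_rat_ae q) => w /= -> _.
Qed.

(** At rational points the function is a.e. an integrable density; other points are enclosed between
    two rational ones. *)
Lemma regularize_integrable x : P.-integrable setT (fun w => (regularize w x)%:E).
Proof.
have x1 : x - 1 < x by rewrite ltrBlDr ltr_pwDr.
have [p] := @rat_in_itvoo R _ _ x1.
rewrite in_itv/= => /andP[_ px].
have [q] := @rat_in_itvoo R x (x + 1) (ltr_pwDr ltr01 (lexx x)).
rewrite in_itv/= => /andP[xq _].
have : P.-integrable setT ((fun w => `|(regularize w (ratr p))%:E|%E) \+
    (fun w => `|(regularize w (ratr q))%:E|%E))%E.
  by apply: integrableD => //; exact: integrable_abse.
apply: le_integrable => // w _ /=; rewrite lee_fin.
rewrite [X in _ <= X]ger0_norm ?addr_ge0//.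
have [_ mono _ _] := regular_regularize.
have l1 := mono w _ _ px; have l2 := mono w _ _ xq.
have n1 := ler_norm (regularize w (ratr q)); have n2 := ler_norm (- regularize w (ratr p)).
rewrite normrN in n2.
have q1 := normr_ge0 (regularize w (ratr q)); have q2 := normr_ge0 (regularize w (ratr p)).
by rewrite ler_norml; apply/andP; split; lra.
Qed.

Let uM := mean_additive_utility (regularF sG regular_regularize) regularize_integrable.

(** At irrational [x] nothing yet links [r x] to [regularize]. Both sides are continuous in [x] and
    agree at rationals decreasing to [x]. *)
Lemma mean_regularize_cst x A : G A ->
  V (glue A (cst x) (cst 0)) = mean P regularize (glue A (cst x) (cst 0)).
Proof.
move=> GA; have mA := sigma_measurable sG GA.
have rat_case q : V (glue A (cst (ratr q)) (cst 0)) =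
    mean P regularize (glue A (cst (ratr q)) (cst 0)).
  rewrite (mean_glue _ (regularF sG regular_regularize))// -rE//; congr fine.
  apply: ae_eq_integral => //.
  - by apply/measurable_EFinP; apply: measurable_funTS; exact: (G_meas_measurable sG).
  - by apply: measurable_funTS; exact: mu_reg.
  - by apply: filterS (regularize_rat_ae q) => w /= -> _.
have /choice[q qP] : forall n : nat, exists q : rat, x < ratr q < x + n.+1%:R^-1.
  move=> n; have lt : x < x + n.+1%:R^-1 by rewrite ltrDl invr_gt0 ltr0n.
  by have [q] := @rat_in_itvoo R _ _ lt; rewrite in_itv/=; exists q.
have qx : (ratr (q n) : R) @[n --> \oo] --> x.
  apply: (@squeeze_cvgr _ _ _ _ (cst x) (fun n => x + harmonic n)).
  - by near=> n; have /andP[h1 h2] := qP n; rewrite /= !ltW.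
  - exact: cvg_cst.
  - rewrite -[X in _ --> X]addr0; apply: cvgD; first exact: cvg_cst.
    exact: cvg_harmonic.
have key W : additive_utility P W ->
    W (glue A (cst (ratr (q n))) (cst 0)) @[n --> \oo] --> W (glue A (cst x) (cst 0)).
  move=> uW; apply: (util_cvg uW).
  - by move=> n; exact: act_glue.
  - exact: act_glue.
  - exists (`|x| + 1) => n w; have /andP[h1 h2] := qP n.
    have h3 : (n.+1%:R^-1 : R) <= 1 by rewrite invf_le1 ?ltr0n// ler1n.
    rewrite /glue; case: ifP => _ /=; last by rewrite normr0 addr_ge0.
    have n1 := ler_norm x; have n2 := ler_norm (- x); rewrite normrN in n2.
    move: h2 h3; move: (n.+1%:R^-1) => v h2 h3.
    by rewrite ler_norml; apply/andP; split; lra.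
  - apply: aeW => w; have [Aw|nA] := pselect (A w).
      by rewrite glueT//; under eq_fun do rewrite glueT//.
    by rewrite glueF//; under eq_fun do rewrite glueF//; exact: cvg_cst.
apply: (cvg_uniq_lim (key _ uV)).
rewrite (_ : (fun n => _) = (fun n => mean P regularize (glue A (cst (ratr (q n))) (cst 0)))).
  exact: (key _ uM).
by apply/funext => n; exact: rat_case.
Unshelve. all: by end_near. Qed.

Lemma mean_regularize f : Linf_rep G f -> V f = mean P regularize f.
Proof.
by apply: (additive_utility_eq uV uM sG) => x A GA; exact: mean_regularize_cst.
Qed.

End regular_version.

Section exists_regular_version.
Context {d : measure_display} {T : measurableType d} {R : realType}.
Variable P : probability T R.

Lemma exists_regular_utility (V : (T -> R) -> R) G : additive_utility P V ->
  (forall x y A, x < y -> measurable A -> 0 < pr P A ->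
    V (glue A (cst x) (cst 0)) < V (glue A (cst y) (cst 0))) ->
  sub_sigma G ->
  exists u : T -> R -> R, [/\ regular G u,
    forall x, P.-integrable setT (fun w => (u w x)%:E) &
    forall f, Linf_rep G f -> V f = mean P u f].
Proof.
move=> uV V_lt sG.
have [r rP] := choice (util_density uV sG).
exists (regularize r); split.
- exact: (regular_regularize sG rP).
- exact: (regularize_integrable uV V_lt sG rP).
- exact: (mean_regularize uV V_lt sG rP).
Qed.

End exists_regular_version.

(** * Nonlinear expectations *)

Section nonlinear_expectation.
Context {d : measure_display} {T : measurableType d} {R : realType}.
Variable P : probability T R.
Local Notation act := (@Linf_rep d T R (@Fsig d T)).

Lemma ae_exists (Q : T -> Prop) : {ae P, forall w, Q w} -> exists w, Q w.
Proof.
move=> [N [mN N0 QN]]; apply: contrapT => /forallNP nQ.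
have : N = setT by apply/seteqP; split => // w _; apply: QN; exact: nQ.
move=> NT; move: N0; rewrite NT probability_setT => /eqP.
by rewrite onee_eq0.
Qed.

Lemma trivsig_cst (h : T -> R) w w' : G_meas trivsig h -> h w = h w'.
Proof.
move=> /(_ [set h w] (measurable_set1 _))[e|e].
  by have : set0 w by rewrite -e.
by have : setT w' by []; rewrite -e /= => ->.
Qed.

Lemma Rintegral_EFin A (f g : T -> R) : measurable A ->
  P.-integrable A (EFin \o f) -> P.-integrable A (EFin \o g) ->
  \int[P]_(w in A) f w = \int[P]_(w in A) g w ->
  (\int[P]_(w in A) (f w)%:E = \int[P]_(w in A) (g w)%:E)%E.
Proof.
move=> mA fi gi e.
by rewrite -[LHS]fineK ?integrable_fin_num// -[RHS]fineK ?integrable_fin_num//; congr (_%:E).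
Qed.

(* Functions measurable for this sigma-algebra are constant on [A]; conditioning on it
   turns locality and time consistency into the sure-thing principle on [A]. *)
Definition atomsig (A : set T) : set (set T) :=
  [set B | measurable B /\ (A `<=` B \/ A `&` B `<=` set0)].

Lemma sub_sigma_atomsig A : sub_sigma (atomsig A).
Proof.
split; last by move=> B [].
split.
- by split; [exact: measurable0|right => w []].
- move=> B [mB h]; rewrite setTD; split; first exact: measurableC.
  case: h => [AB|AB]; [right => w [Aw]; apply; exact: AB|left => w Aw Bw].
  by apply: (AB w).
- move=> F hF; split; first by apply: bigcupT_measurable => n; case: (hF n).
  have [[n An]|nA] := pselect (exists n, A `<=` F n).
    by left => w /An Fw; exists n.
  right => w [Aw [n _ Fw]]; have [_ [An|]] := hF n; first by apply: nA; exists n.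
  by move=> /(_ w); apply.
Qed.

Lemma atomsig_cst A (h : T -> R) w w' : G_meas (atomsig A) h -> A w -> A w' -> h w = h w'.
Proof.
move=> /(_ [set h w] (measurable_set1 _))[_ [AB|AB]] Aw Aw'.
  by have /= -> := AB _ Aw'.
by exfalso; apply: (AB w).
Qed.

Variable E : set (set T) -> (T -> R) -> (T -> R).
Hypothesis naP : nonatomic P.
Hypothesis famE : Linf_family P E.

Lemma fam_rep G f : sub_sigma G -> act f -> Linf_rep G (E G f).
Proof. by move=> /famE[h _]; exact: h. Qed.

Lemma fam_act G f : sub_sigma G -> act f -> act (E G f).
Proof. by move=> sG af; apply: (Linf_repF sG); exact: fam_rep. Qed.

Lemma fam_ae G f g : sub_sigma G -> act f -> act g -> aeeq P f g -> aeeq P (E G f) (E G g).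
Proof. by move=> /famE[_ h]; exact: h. Qed.

Lemma fam_triv_cst f w w' : act f -> E trivsig f w = E trivsig f w'.
Proof. by move=> af; apply: trivsig_cst; case: (fam_rep sub_sigma_triv af). Qed.

(** * From the axioms to the representation *)

Section necessity.
Hypothesis locE : cond_nonlin_exp P E.
Hypothesis tcE : time_consistent E.
Hypothesis smE : strict_mono_dichotomic P E.
Hypothesis pcE : pointwise_continuous P E.

(** [E trivsig f] is a constant function, so any point of evaluation gives its value. *)
Let I (f : T -> R) : R := E trivsig f point.

Let I_ae f g : act f -> act g -> aeeq P f g -> I f = I g.
Proof.
move=> af ag fg; have [w e] := ae_exists (fam_ae sub_sigma_triv af ag fg).
by rewrite /I (fam_triv_cst _ w af) e; exact: fam_triv_cst.
Qed.

Let I_lt x y Z A : x < y -> act Z -> measurable A -> 0 < pr P A ->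
  I (glue A (cst x) Z) < I (glue A (cst y) Z).
Proof.
by move=> xy aZ mA A0; rewrite -!glue_indic; apply: smE => //; rewrite pr_gt0.
Qed.

Let I_tc G f : sub_sigma G -> act f -> I (E G f) = I f.
Proof. by move=> sG af; exact: tcE. Qed.

(** Time consistency for the trivial sigma-algebra gives [I (I c) = I c], and [I] is strictly
    increasing on constants. *)
Let I_cst c : I (cst c) = c.
Proof.
have gT x : glue setT (cst x) (cst 0) = cst x :> (T -> R).
  by apply/funext => w; rewrite glueT.
have lt x y : x < y -> I (cst x) < I (cst y).
  move=> xy; rewrite -(gT x) -(gT y); apply: I_lt => //.
  by rewrite /pr probability_setT.
have e : I (cst (I (cst c))) = I (cst c).
  rewrite -[RHS](I_tc sub_sigma_triv)//; congr I; apply/funext => w.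
  exact: fam_triv_cst.
by apply/eqP; rewrite eq_le !leNgt; apply/andP; split; apply/negP => /lt; rewrite e ltxx.
Qed.

Let E_loc G f A : sub_sigma G -> act f -> G A ->
  aeeq P (E G (glue A f (cst 0))) (glue A (E G f) (cst 0)).
Proof. by move=> sG af GA; rewrite -!mul_indic; exact: locE. Qed.

(** Conditioning replaces [X] on [A] by a constant [al X] and [Z] off [A] by [be Z]. The ranking is
    then that of [al X] and [al X'], whatever the background. *)
Let I_sure_thing A X X' Z Z' : measurable A -> act X -> act X' -> act Z -> act Z' ->
  I (glue A X Z) <= I (glue A X' Z) -> I (glue A X Z') <= I (glue A X' Z').
Proof.
move=> mA aX aX' aZ aZ'; have [A0|A0] := eqVneq (P A) 0%E.
  move=> _; rewrite le_eqVlt; apply/orP; left; apply/eqP.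
  apply: I_ae; do ?exact: act_glue.
  exists A; split => // w /= h; apply: contrapT => nA; apply: h.
  by rewrite !glueF.
have A1 := pr_neq0 mA A0.
have [wA AwA] : exists w, A w.
  apply: contrapT => /forallNP nA; have A00 : A = set0 by apply/seteqP; split => // w /nA.
  by move: A1; rewrite A00 /pr measure0 ltxx.
pose G := atomsig A; have sG : sub_sigma G := sub_sigma_atomsig A.
have GA : G A by split => //; left.
have GC : G (~` A) by exact: (sigmaC sG).
pose al Y := E G (glue A Y (cst 0)) wA.
pose be Y := E G (glue (~` A) Y (cst 0)).
have key Y W : act Y -> act W -> I (glue A Y W) = I (glue A (cst (al Y)) (be W)).
  move=> aY aW.
  have aYW : act (glue A Y W) by exact: act_glue.
  have aY0 : act (glue A Y (cst 0)) by exact: act_glue.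
  have aW0 : act (glue (~` A) W (cst 0)) by apply: act_glue => //; exact: measurableC.
  rewrite -(I_tc sG)//; apply: I_ae.
  - exact: fam_act.
  - by apply: act_glue => //; exact: fam_act.
  have h1 := E_loc sG aYW GA; have h2 := E_loc sG aYW GC.
  rewrite (_ : glue A (glue A Y W) (cst 0) = glue A Y (cst 0)) in h1; last first.
    by apply: glue_eq => // w Aw; rewrite glueT.
  rewrite (_ : glue (~` A) (glue A Y W) (cst 0) = glue (~` A) W (cst 0)) in h2; last first.
    by apply: glue_eq => // w nA; rewrite glueF.
  apply: filterS2 h1 h2 => w e1 e2; have [Aw|nA] := pselect (A w).
    move: e1; rewrite glueT// => <-; rewrite glueT//= /al.
    by apply: (@atomsig_cst A) => //; case: (fam_rep sG aY0).
  by move: e2; rewrite glueT// => <-; rewrite glueF.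
have abe W : act W -> act (be W).
  by move=> aW; apply: fam_act => //; apply: act_glue => //; exact: measurableC.
rewrite (key X Z)// (key X' Z)// (key X Z')// (key X' Z')// => h.
have le : al X <= al X'.
  by rewrite leNgt; apply/negP => lt; have := I_lt lt (abe _ aZ) mA A1; rewrite ltNge h.
move: le; rewrite le_eqVlt => /predU1P[->//|lt].
by apply: ltW; apply: I_lt => //; exact: abe.
Qed.

Lemma pref_nonlinear_expectation : preference P I.
Proof.
split.
- exact: I_ae.
- by move=> X f aX af bX Xf; exact: pcE.
- exact: I_lt.
- exact: I_cst.
- exact: I_sure_thing.
Qed.

Lemma utility_representation : exists u : T -> R -> R,
     [/\ regular Fsig u,
         forall x, P.-integrable setT (fun w => (u w x)%:E) &
         forall G, sub_sigma G ->
           exists uG : T -> R -> R,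
             [/\ regular G uG,
                 forall x, P.-integrable setT (fun w => (uG w x)%:E) /\
                           condexp_version P G (fun w => u w x) (fun w => uG w x) &
                 forall f, Linf_rep Fsig f ->
                   (exists h, condexp_version P G (fun w => u w (f w)) h /\
                              forall w, exists y, h w = uG w y) /\
                   (forall h, condexp_version P G (fun w => u w (f w)) h ->
                              (forall w, exists y, h w = uG w y) ->
                              aeeq P (E G f) (fun w => Phi uG w (h w)))]].
Proof.
have [phi [phi_lt uV]] := exists_additive_utility naP pref_nonlinear_expectation.
pose V := phi \o I.
have V_lt x y A : x < y -> measurable A -> 0 < pr P A ->
    V (glue A (cst x) (cst 0)) < V (glue A (cst y) (cst 0)).
  by move=> xy mA A0; apply: phi_lt; exact: I_lt.
have [u [ru iu Vu]] := exists_regular_utility uV V_lt sub_sigmaF.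
exists u; split => // G sG.
have [v [rv iv Vv]] := exists_regular_utility uV V_lt sG.
have rvF := regularF sG rv.
(* [u] and [v] represent the same [V], on all acts and on [G]-measurable ones. Constants [f = g]
   will show that [v] is the conditional expectation of [u], and [g = E G f] will give the formula
   for [E G f]. *)
have mean_eq f g A : act f -> Linf_rep G g -> G A ->
    V (glue A f (cst 0)) = V (glue A g (cst 0)) ->
    (\int[P]_(w in A) (v w (g w))%:E = \int[P]_(w in A) (u w (f w))%:E)%E.
  move=> af Gg GA e; have mA := sigma_measurable sG GA.
  apply: Rintegral_EFin => //.
  - exact: (mean_integrable rvF iv (Linf_repF sG Gg)).
  - exact: (mean_integrable ru iu).
  - rewrite -(mean_glue P rvF)// -(mean_glue P ru)// -Vv; last first.
      by apply: (Linf_rep_glue sG) => //; exact: (Linf_rep_cst sG).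
    by rewrite -Vu ?e//; exact: act_glue.
exists v; split => //.
  move=> x; split => //; split => //.
    exact: (regular_G_meas sG rv (G_meas_cst sG x)).
    exact: (iv x).
  by move=> A GA; apply: (@mean_eq (cst x) (cst x)) => //; exact: (Linf_rep_cst sG).
move=> f af.
have GEf := fam_rep sG af.
have cv : condexp_version P G (fun w => u w (f w)) (fun w => v w (E G f w)).
  split.
  - by apply: (regular_G_meas sG rv); case: GEf.
  - exact: (mean_integrable rvF iv (Linf_repF sG GEf) measurableT).
  - move=> A GA; have mA := sigma_measurable sG GA.
    apply: mean_eq => //.
    have aA : act (glue A f (cst 0)) by exact: act_glue.
    (* Time consistency for [f 1_A], then locality of [E G]. *)
    rewrite /V /= -[in LHS](I_tc sG aA); congr phi; apply: I_ae.
    + exact: fam_act.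
    + by apply: act_glue => //; exact: fam_act.
    + exact: E_loc.
split; first by exists (fun w => v w (E G f w)); split => // w; exists (E G f w).
move=> h [mh ih hE] _; case: cv => mk ik kE.
have : aeeq P h (fun w => v w (E G f w)).
  apply: (ae_eq_condexp sG) => // A GA.
  by rewrite /Rintegral hE// kE.
by apply: filterS => w ->; rewrite (Phi_regular _ _ rv).
Qed.

End necessity.

(** * From the representation to the axioms *)

Section sufficiency.
Variable u : T -> R -> R.
Hypothesis ru : regular Fsig u.
Hypothesis iu : forall x, P.-integrable setT (fun w => (u w x)%:E).
Hypothesis repE : forall G, sub_sigma G ->
           exists uG : T -> R -> R,
             [/\ regular G uG,
                 forall x, P.-integrable setT (fun w => (uG w x)%:E) /\
                           condexp_version P G (fun w => u w x) (fun w => uG w x) &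
                 forall f, Linf_rep Fsig f ->
                   (exists h, condexp_version P G (fun w => u w (f w)) h /\
                              forall w, exists y, h w = uG w y) /\
                   (forall h, condexp_version P G (fun w => u w (f w)) h ->
                              (forall w, exists y, h w = uG w y) ->
                              aeeq P (E G f) (fun w => Phi uG w (h w)))].

Let J := mean P u.
Let uJ : additive_utility P J := mean_additive_utility ru iu.

(** The last clause removes [Phi]: each value of [h] is some [v w y], and [Phi] returns that [y]. *)
Let rep_mean G : sub_sigma G -> exists v : T -> R -> R, [/\ regular G v,
  forall x, P.-integrable setT (fun w => (v w x)%:E),
  forall f, Linf_rep G f -> J f = mean P v f &
  forall f A, act f -> G A -> \int[P]_(w in A) v w (E G f w) = \int[P]_(w in A) u w (f w)].
Proof.
move=> sG; have [v [rv iv fv]] := repE sG; exists v.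
have iv' x : P.-integrable setT (fun w => (v w x)%:E) by case: (iv x).
have rvF := regularF sG rv.
split => //.
  apply: (additive_utility_eq uJ (mean_additive_utility rvF iv') sG) => x A GA.
  have mA := sigma_measurable sG GA.
  rewrite /J (mean_glue P ru)// (mean_glue P rvF)//.
  by have [_ [_ _ e]] := iv x; rewrite /Rintegral/= e.
move=> f A af GA; have [[h [cv hr]] /(_ h cv hr) eE] := fv f af.
have mA := sigma_measurable sG GA.
case: cv => mh ih hE; rewrite /Rintegral -hE//; congr fine.
apply: ae_eq_integral => //.
- exact: measurable_int (mean_integrable rvF iv' (fam_act sG af) mA).
- apply: measurable_funTS; exact: measurable_int ih.
- apply: filterS eE => w -> _; have [y ->] := hr w.
  by rewrite (Phi_regular _ _ rv).
Qed.

Let J_cond G f : sub_sigma G -> act f -> J (E G f) = J f.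
Proof.
move=> sG af; have [v [rv iv Jv vE]] := rep_mean sG.
rewrite Jv; last exact: fam_rep.
by rewrite /mean vE//; exact: (sigmaT sG).
Qed.

Let J_lt x y Z A : x < y -> act Z -> measurable A -> 0 < pr P A ->
  J (glue A (cst x) Z) < J (glue A (cst y) Z).
Proof.
move=> xy aZ mA A0.
have split_ c : J (glue A (cst c) Z) =
    \int[P]_(w in A) u w c + J (glue (~` A) Z (cst 0)).
  rewrite (util_add uJ mA); last exact: act_glue.
  rewrite -(mean_glue P ru (cst c) mA); congr (J _ + J _).
    by apply: glue_eq => // w Aw; rewrite glueT.
  by apply: glue_eq => // w nA; rewrite glueF.
rewrite !split_ ltrD2r -subr_gt0.
have ic c : P.-integrable A (EFin \o (fun w => u w c)) by exact: integrableS (iu c).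
rewrite -RintegralB//; apply: Rintegral_gt0 => //.
  have -> : EFin \o (fun w => u w y - u w x) =
    ((EFin \o (fun w => u w y)) \- (EFin \o (fun w => u w x)))%E by [].
  exact: integrableB.
by move=> w _; rewrite subr_gt0; case: ru => _ h _ _; exact: h.
Qed.

Let psi x := J (cst x).

Let psi_lt x y : x < y -> psi x < psi y.
Proof.
have gT c : glue setT (cst c) (cst 0) = cst c :> (T -> R).
  by apply/funext => w; rewrite glueT.
move=> xy; rewrite /psi -(gT x) -(gT y); apply: J_lt => //.
by rewrite /pr probability_setT.
Qed.

Let psi_inj x y : psi x = psi y -> x = y.
Proof.
by move=> e; apply/eqP; rewrite eq_le !leNgt; apply/andP; split; apply/negP => /psi_lt;
  rewrite e ltxx.
Qed.

Let psiE f w : act f -> psi (E trivsig f w) = J f.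
Proof.
move=> af; rewrite -(J_cond sub_sigma_triv af) /psi; congr J.
by apply/funext => w'; exact: fam_triv_cst.
Qed.

Lemma representation_axioms : [/\ cond_nonlin_exp P E, time_consistent E,
  strict_mono_dichotomic P E & pointwise_continuous P E].
Proof.
split.
- move=> G sG f af A GA; rewrite !mul_indic.
  have [v [rv iv Jv vE]] := rep_mean sG.
  have rvF := regularF sG rv; have mA := sigma_measurable sG GA.
  have aA : act (glue A f (cst 0)) by exact: act_glue.
  have GA' := fam_rep sG aA.
  have GE : Linf_rep G (glue A (E G f) (cst 0)).
    by apply: (Linf_rep_glue sG) => //; [exact: fam_rep|exact: (Linf_rep_cst sG)].
  (* Over [B] in [G], both sides integrate to the integral of [u (f)] over the intersection of [B]
     and [A]; [v] is then cancelled by injectivity. *)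
  have : aeeq P (fun w => v w (E G (glue A f (cst 0)) w))
      (fun w => v w (glue A (E G f) (cst 0) w)).
    apply: (ae_eq_condexp sG).
    + by apply: (regular_G_meas sG rv); case: GA'.
    + by apply: (regular_G_meas sG rv); case: GE.
    + exact: (mean_integrable rvF iv (Linf_repF sG GA') measurableT).
    + exact: (mean_integrable rvF iv (Linf_repF sG GE) measurableT).
    + move=> B GB; have mB := sigma_measurable sG GB.
      rewrite vE// -(mean_glue P ru)// -(mean_glue P rvF)//.
      have gI (g : T -> R) : glue B (glue A g (cst 0)) (cst 0) = glue (B `&` A) g (cst 0).
        apply/funext => w; rewrite /glue in_setI.
        by case: (w \in B); case: (w \in A).
      have mBA : measurable (B `&` A) by exact: measurableI.
      rewrite !gI (mean_glue P ru)// (mean_glue P rvF)// vE//.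
      exact: (sigmaI sG).
  by apply: filterS => w e; exact: (regular_inj rv e).
- move=> G sG f af w; apply: psi_inj; rewrite !psiE//; last exact: fam_act.
  exact: J_cond.
- move=> x y Z A xy aZ mA; rewrite pr_gt0// => A0 w.
  rewrite -[ltLHS]/(E trivsig (fun v => cst x v * \1_A v + Z v * \1_(~` A) v) w).
  rewrite -[ltRHS]/(E trivsig (fun v => cst y v * \1_A v + Z v * \1_(~` A) v) w).
  rewrite !glue_indic.
  have h := J_lt xy aZ mA A0.
  rewrite ltNge; apply/negP => le; move: h.
  rewrite -(psiE w (act_glue mA (act_cst x) aZ)) -(psiE w (act_glue mA (act_cst y) aZ)).
  by move: le; rewrite le_eqVlt => /predU1P[->|/psi_lt h /lt_trans/(_ h)]; rewrite ltxx.
- move=> X f aX af bX Xf w.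
  have lim := util_cvg uJ aX af bX Xf.
  apply/cvgrPdist_lt => e e0.
  (* Convergence is known only after applying [psi]; its strict monotonicity traps
     [E trivsig (X n) w] within [e]. *)
  have l1 : psi (E trivsig f w - e) < J f.
    by rewrite -(psiE w af); apply: psi_lt; rewrite ltrBlDr ltrDl.
  have l2 : J f < psi (E trivsig f w + e).
    by rewrite -(psiE w af); apply: psi_lt; rewrite ltrDl.
  have N1 := cvgr_gt _ lim _ l1; have N2 := cvgr_lt _ lim _ l2.
  near=> n.
  have m1 : psi (E trivsig f w - e) < psi (E trivsig (X n) w).
    by rewrite psiE//; near: n; exact: N1.
  have m2 : psi (E trivsig (X n) w) < psi (E trivsig f w + e).
    by rewrite psiE//; near: n; exact: N2.
  have psi_lt_rev x y : psi x < psi y -> x < y.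
    move=> h; rewrite ltNge; apply/negP; rewrite le_eqVlt => /predU1P[e'|/psi_lt h'].
      by move: h; rewrite e' ltxx.
    by have := lt_trans h h'; rewrite ltxx.
  have := psi_lt_rev _ _ m1; have := psi_lt_rev _ _ m2 => k2 k1.
  by rewrite ltr_norml; apply/andP; split; lra.
Unshelve. all: by end_near. Qed.

End sufficiency.
End nonlinear_expectation.

Unset Implicit Arguments.

Theorem mainTheorem1 (d : measure_display) (T : measurableType d)
    (R : realType) (P : probability T R)
    (E : set (set T) -> (T -> R) -> (T -> R)) :
  nonatomic P -> Linf_family P E ->
  ([/\ cond_nonlin_exp P E, time_consistent E,
       strict_mono_dichotomic P E & pointwise_continuous P E]
   <->
   exists u : T -> R -> R,
     [/\ regular Fsig u,
         forall x, P.-integrable setT (fun w => (u w x)%:E) &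
         forall G, sub_sigma G ->
           exists uG : T -> R -> R,
             [/\ regular G uG,
                 forall x, P.-integrable setT (fun w => (uG w x)%:E) /\
                           condexp_version P G (fun w => u w x) (fun w => uG w x) &
                 forall f, Linf_rep Fsig f ->
                   (exists h, condexp_version P G (fun w => u w (f w)) h /\
                              forall w, exists y, h w = uG w y) /\
                   (forall h, condexp_version P G (fun w => u w (f w)) h ->
                              (forall w, exists y, h w = uG w y) ->
                              aeeq P (E G f) (fun w => Phi uG w (h w)))]]).

Proof.
move=> naP famE; split=> [[locE tcE smE pcE]|[u [ru iu repE]]].
  exact: utility_representation.
exact: (representation_axioms famE ru iu repE).
Qed.
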